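(* Let $\mathcal{L}'$ be a first-order language and $\mathcal{I}$ an infinite locally finite $\mathcal{L}'$-structure. Then the following are equivalent: (1) $\mathrm{age}(\mathcal{I})$ has the embedding Ramsey property; (2) $\mathcal{I}$-indexed indiscernibles have the continuous modeling property in every continuous logic theory.
   Context: Continuous logic is in the sense of Ben Yaacov–Berenstein–Henson–Usvyatsov: formulas take real values (in a bounded interval), and the type of a tuple over a set is determined by the values of formulas with parameters from that set. For a complete continuous theory $T$ with monster model $\mathfrak{C}$: an $\mathcal{I}$-indexed sequence $(a_i)_{i\in\mathcal{I}}$ of tuples of $\mathfrak{C}$ is $\mathcal{I}$-indiscernible if for all $n$ and $i_1,\dots,i_n,j_1,\dots,j_n\in\mathcal{I}$ with the same quantifier-free $\mathcal{L}'$-type, $\mathrm{tp}(a_{i_1},\dots,a_{i_n})=\mathrm{tp}(a_{j_1},\dots,a_{j_n})$. A $\mathcal{I}$-indexed sequence $(b_i)$ is locally based on $(a_i)$ if for every finite set $\Delta$ of formulas, finite tuple $\bar j\subseteq\mathcal{I}$ and $\varepsilon>0$ there is $\bar i\subseteq\mathcal{I}$ with the same quantifier-free $\mathcal{L}'$-type as $\bar j$ and $|\varphi(b_{\bar j})-\varphi(a_{\bar i})|\leq\varepsilon$ for all $\varphi\in\Delta$. $\mathcal{I}$-indexed indiscernibles have the continuous modeling property in $T$ if for every $\mathcal{I}$-indexed sequence in $\mathfrak{C}$ there is an $\mathcal{I}$-indiscernible sequence in $\mathfrak{C}$ locally based on it. $\mathcal{I}$ is locally finite if every finitely generated substructure is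 finite; $\mathrm{age}(\mathcal{I})$ is the class of (isomorphism types of) finitely generated substructures of $\mathcal{I}$. For $\mathcal{L}'$-structures $A\subseteq B\subseteq C$, $\binom{B}{A}$ is the set of embeddings $A\to B$, and $C\to(B)^A_r$ means that for every $\chi:\binom{C}{A}\to r$ there is $f\in\binom{C}{B}$ with $\chi$ constant on $\{f\circ g: g\in\binom{B}{A}\}$. A class $\mathcal{K}$ of finite structures has the embedding Ramsey property if for all $A\subseteq B\in\mathcal{K}$ and $r<\omega$ there is $C\in\mathcal{K}$ with $C\to(B)^A_r$. *)

(* Defs.v *)
From mathcomp Require Import all_boot all_order all_algebra.
From mathcomp Require Import mathcomp_extra boolp classical_sets functions.
From mathcomp Require Import cardinality reals topology normedtype.

Set Implicit Arguments.
Unset Strict Implicit.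
Unset Printing Implicit Defensive.

Import Order.TTheory GRing.Theory Num.Theory.
Import numFieldNormedType.Exports.

Local Open Scope classical_set_scope.
Local Open Scope card_scope.
Local Open Scope ring_scope.

Definition card_lt (T U : Type) (A : set T) (B : set U) : Prop :=
  (A #<= B) /\ ~ (B #<= A).

(* Shared by first-order and continuous logic; constants are 0-ary symbols,
   and free variables range over an arbitrary type V. *)
Inductive term (F : Type) (ar : F -> nat) (V : Type) : Type :=
| Var of V
| App (f : F) of ('I_(ar f) -> term ar V).

Fixpoint teval (F : Type) (ar : F -> nat) (V M : Type)
    (I : forall f, ('I_(ar f) -> M) -> M) (a : V -> M) (t : term ar V) : M :=
  match t with
  | Var v => a v
  | App f args => I f (fun i => teval I a (args i))
  end.

(** * First-order structures *)

Record folang := FoLang {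
  fo_fun : Type;
  fo_far : fo_fun -> nat;
  fo_rel : Type;
  fo_rar : fo_rel -> nat }.

Record fostruct (L : folang) := FoStruct {
  fo_car :> Type;
  fo_funI : forall f : fo_fun L, ('I_(fo_far f) -> fo_car) -> fo_car;
  fo_relI : forall r : fo_rel L, ('I_(fo_rar r) -> fo_car) -> Prop }.

Inductive qfformula (L : folang) (V : Type) : Type :=
| QFalse
| QEq of term (@fo_far L) V & term (@fo_far L) V
| QRel (r : fo_rel L) of ('I_(fo_rar r) -> term (@fo_far L) V)
| QNot of qfformula L V
| QAnd of qfformula L V & qfformula L V.

Fixpoint qfsat (L : folang) (V : Type) (M : fostruct L) (a : V -> M)
    (psi : qfformula L V) : Prop :=
  match psi with
  | QFalse => False
  | QEq s t => teval (@fo_funI L M) a s = teval (@fo_funI L M) a t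
  | QRel r args => fo_relI (fun i => teval (@fo_funI L M) a (args i))
  | QNot p => ~ qfsat a p
  | QAnd p q => qfsat a p /\ qfsat a q
  end.

Definition same_qftp (L : folang) (M : fostruct L) (n : nat)
    (i j : 'I_n -> M) : Prop :=
  forall psi : qfformula L 'I_n, qfsat i psi <-> qfsat j psi.

Definition is_embedding (L : folang) (M N : fostruct L) (g : M -> N) : Prop :=
  [/\ injective g,
      forall (f : fo_fun L) (x : 'I_(fo_far f) -> M),
        g (fo_funI x) = fo_funI (g \o x)
    & forall (r : fo_rel L) (x : 'I_(fo_rar r) -> M),
        fo_relI x <-> fo_relI (g \o x)].

(* [embedding A B] is the set written $\binom{B}{A}$. *)
Record embedding (L : folang) (M N : fostruct L) := Embedding {
  emb_fun :> M -> N;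
  embP : is_embedding emb_fun }.

Lemma is_embedding_comp (L : folang) (M N P : fostruct L)
    (g : embedding N P) (f : embedding M N) : is_embedding (g \o f).
Proof.
case: g f => [g [gi gf gr]] [f [fi ff fr]] /=; split.
- exact: inj_comp.
- by move=> s x /=; rewrite ff gf.
- by move=> r x; split=> [/fr/gr|?] //; apply/fr/gr.
Qed.

Definition emb_comp (L : folang) (M N P : fostruct L)
    (g : embedding N P) (f : embedding M N) : embedding M P :=
  Embedding (is_embedding_comp g f).

Definition isomorphic (L : folang) (M N : fostruct L) : Prop :=
  exists g : M -> N, is_embedding g /\ bijective g.

Record substruct (L : folang) (M : fostruct L) := Substruct {
  sub_set :> set M;
  sub_closed : forall (f : fo_fun L) (x : 'I_(fo_far f) -> M),
    (forall i, sub_set (x i)) -> sub_set (fo_funI x) }.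

Lemma sub_fun_in (L : folang) (M : fostruct L) (A : substruct M)
    (f : fo_fun L) (x : 'I_(fo_far f) -> sub_set A) :
  fo_funI (fun i => val (x i)) \in sub_set A.
Proof. by apply/mem_set/sub_closed => i; apply/set_mem/valP. Qed.

Definition sub_str (L : folang) (M : fostruct L) (A : substruct M) :
    fostruct L :=
  @FoStruct L (sub_set A)
    (fun f x => SigSub (sub_fun_in x))
    (fun r x => fo_relI (fun i => val (x i))).

Definition generates (L : folang) (M : fostruct L) (X : set M)
    (A : substruct M) : Prop :=
  X `<=` A /\ forall A' : substruct M, X `<=` A' -> A `<=` A'.

Definition finitely_generated (L : folang) (M : fostruct L)
    (A : substruct M) : Prop :=
  exists X : set M, finite_set X /\ generates X A.

Definition locally_finite (L : folang) (M : fostruct L) : Prop :=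
  forall A : substruct M, finitely_generated A -> finite_set (sub_set A).

Definition age (L : folang) (M : fostruct L) : fostruct L -> Prop :=
  fun S => exists A : substruct M, finitely_generated A /\
    isomorphic S (sub_str A).

(* [ramsey_arrow C B A r] is C -> (B)^A_r. *)
Definition ramsey_arrow (L : folang) (C B A : fostruct L) (r : nat) : Prop :=
  forall chi : embedding A C -> 'I_r, exists f : embedding B C,
    forall g g' : embedding A B, chi (emb_comp f g) = chi (emb_comp f g').

Definition embedding_ramsey_property (L : folang)
    (K : fostruct L -> Prop) : Prop :=
  forall B : fostruct L, K B -> forall A : substruct B, K (sub_str A) ->
  forall r : nat, exists C : fostruct L, K C /\ ramsey_arrow C B (sub_str A) r.

(** * Continuous logic

   Conventions of Ben Yaacov, Berenstein, Henson and Usvyatsov, "Model theory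
   for metric structures": one sort, diameter at most 1, and all predicates
   and formulas valued in [0, 1]. *)

Record clang (R : realType) := CLang {
  c_fun : Type;
  c_far : c_fun -> nat;
  c_fmod : c_fun -> R -> R;
  c_pred : Type;
  c_par : c_pred -> nat;
  c_pmod : c_pred -> R -> R;
  c_fmod_range : forall f e, 0 < e <= 1 -> 0 < c_fmod f e <= 1;
  c_pmod_range : forall P e, 0 < e <= 1 -> 0 < c_pmod P e <= 1 }.

(* The hypothesis [forall i, mdist (x i) (y i) < delta] says that x and y are
   delta-close for the maximum metric on a finite power. *)
Record cstruct (R : realType) (L : clang R) := CStruct {
  c_car :> metricType R;
  c_inhabited : inhabited c_car;
  c_diam : forall x y : c_car, mdist x y <= 1;
  c_complete : forall F : set_system c_car,
    ProperFilter F -> cauchy F -> exists x : c_car, F --> x;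
  c_funI : forall f : c_fun L, ('I_(c_far f) -> c_car) -> c_car;
  c_predI : forall P : c_pred L, ('I_(c_par P) -> c_car) -> R;
  c_predI_range : forall (P : c_pred L) x, 0 <= @c_predI P x <= 1;
  c_fun_uc : forall (f : c_fun L) (x y : 'I_(c_far f) -> c_car) (e : R),
    0 < e <= 1 -> (forall i, mdist (x i) (y i) < c_fmod f e) ->
    mdist (c_funI x) (c_funI y) <= e;
  c_pred_uc : forall (P : c_pred L) (x y : 'I_(c_par P) -> c_car) (e : R),
    0 < e <= 1 -> (forall i, mdist (x i) (y i) < c_pmod P e) ->
    `|c_predI x - c_predI y| <= e }.

Definition cube (R : realType) (n : nat) : set 'rV[R]_n :=
  [set x | forall i, 0 <= x ord0 i <= 1].

(* Only the restriction of [conn_fun] to the cube is meaningful. *)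
Record connective (R : realType) (n : nat) := Connective {
  conn_fun :> 'rV[R]_n -> R;
  conn_range : forall x, cube x -> 0 <= conn_fun x <= 1;
  conn_cont : {within @cube R n, continuous conn_fun} }.

(* In [CSup] and [CInf] the bound variable is [None]. *)
Inductive cformula (R : realType) (L : clang R) (V : Type) : Type :=
| CDist of term (@c_far R L) V & term (@c_far R L) V
| CPred (P : c_pred L) of ('I_(c_par P) -> term (@c_far R L) V)
| CConn (n : nat) of connective R n & ('I_n -> cformula L V)
| CSup of cformula L (option V)
| CInf of cformula L (option V).

Definition assign_ext (V M : Type) (a : V -> M) (x : M) (v : option V) : M :=
  if v is Some w then a w else x.

Fixpoint ceval (R : realType) (L : clang R) (M : cstruct L) (V : Type)
    (phi : cformula L V) (a : V -> M) : R :=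
  match phi with
  | CDist s t =>
      mdist (teval (@c_funI R L M) a s) (teval (@c_funI R L M) a t)
  | CPred P args => c_predI (fun i => teval (@c_funI R L M) a (args i))
  | CConn n u args => u (\row_(i < n) ceval (args i) a)
  | CSup p => sup [set ceval p (assign_ext a x) | x in [set: M]]
  | CInf p => inf [set ceval p (assign_ext a x) | x in [set: M]]
  end.

(* Equality of types over the empty set. *)
Definition same_tp (R : realType) (L : clang R) (M : cstruct L) (V : Type)
    (a b : V -> M) : Prop :=
  forall phi : cformula L V, ceval phi a = ceval phi b.

(* A sentence sigma stands for the closed condition sigma = 0. *)
Definition csentence (R : realType) (L : clang R) := cformula L void.

Definition ctheory (R : realType) (L : clang R) := set (csentence L).

Definition Th (R : realType) (L : clang R) (M : cstruct L) : ctheory L :=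
  [set sigma | ceval sigma (of_void M) = 0].

Definition complete_theory (R : realType) (L : clang R) (T : ctheory L) : Prop :=
  exists M : cstruct L, T = Th M.

Definition is_model (R : realType) (L : clang R) (T : ctheory L)
    (M : cstruct L) : Prop :=
  forall sigma, T sigma -> ceval sigma (of_void M) = 0.

(* The formulas of L(A) in n variables are the L-formulas with free variables
   in the disjoint union of 'I_n and A, each a in A being assigned to itself. *)
Definition param_assign (M : Type) (A : set M) (n : nat) (x : 'I_n -> M)
    (v : 'I_n + A) : M :=
  match v with inl i => x i | inr a => val a end.

(* The cardinal kappa is given by a type K of that cardinality. *)
Definition saturated (R : realType) (L : clang R) (K : Type)
    (M : cstruct L) : Prop :=
  forall A : set M, card_lt A [set: K] ->
  forall (n : nat) (Gamma : set (cformula L ('I_n + A))),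
    (forall Gamma0, finite_set Gamma0 -> Gamma0 `<=` Gamma ->
       exists x : 'I_n -> M,
         forall phi, Gamma0 phi -> ceval phi (param_assign x) = 0) ->
    exists x : 'I_n -> M,
      forall phi, Gamma phi -> ceval phi (param_assign x) = 0.

Definition automorphism (R : realType) (L : clang R) (M : cstruct L)
    (g : M -> M) : Prop :=
  [/\ bijective g,
      forall x y, mdist (g x) (g y) = mdist x y,
      forall (f : c_fun L) (x : 'I_(c_far f) -> M),
        g (c_funI x) = c_funI (g \o x)
    & forall (P : c_pred L) (x : 'I_(c_par P) -> M),
        c_predI (g \o x) = c_predI x].

Definition strongly_homogeneous (R : realType) (L : clang R) (K : Type)
    (M : cstruct L) : Prop :=
  forall A : set M, card_lt A [set: K] ->
  forall f : A -> M, same_tp (fun a : A => val a) f ->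
  exists g : M -> M, automorphism g /\ forall a : A, g (val a) = f a.

Definition monster_model (R : realType) (L : clang R) (T : ctheory L)
    (K : Type) (M : cstruct L) : Prop :=
  [/\ is_model T M,
      [/\ card_lt [set: nat] [set: K], card_lt [set: c_fun L] [set: K]
        & card_lt [set: c_pred L] [set: K]],
      saturated K M
    & strongly_homogeneous K M].

(** * Generalized indiscernibles *)

Definition subtuple (I J M : Type) (a : I -> J -> M) (n : nat) (i : 'I_n -> I)
    (v : 'I_n * J) : M := a (i v.1) v.2.

Definition indiscernible (R : realType) (L' : folang) (I : fostruct L')
    (L : clang R) (M : cstruct L) (J : Type)
    (a : I -> J -> M) : Prop :=
  forall (n : nat) (i j : 'I_n -> I), same_qftp i j ->
    same_tp (subtuple a i) (subtuple a j).

Definition locally_based (R : realType) (L' : folang) (I : fostruct L')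
    (L : clang R) (M : cstruct L) (J : Type) (b a : I -> J -> M) : Prop :=
  forall (n : nat) (Delta : set (cformula L ('I_n * J))) (j : 'I_n -> I)
    (e : R), finite_set Delta -> 0 < e ->
  exists i : 'I_n -> I, same_qftp i j /\
    forall phi, Delta phi ->
      `|ceval phi (subtuple b j) - ceval phi (subtuple a i)| <= e.

(* As usual for a monster model, the index structure and the length J of the
   tuples are small, that is, of cardinality less than kappa. *)
Definition continuous_modeling_property (R : realType) (L' : folang)
    (I : fostruct L') (L : clang R) (T : ctheory L) : Prop :=
  forall (K : Type) (M : cstruct L), monster_model T K M ->
    card_lt [set: I] [set: K] ->
  forall J : Type, card_lt [set: J] [set: K] ->
  forall a : I -> J -> M,
  exists b : I -> J -> M, indiscernible b /\ locally_based b a.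

(* Main.v *)
(** Ramsey implies modeling: given a sequence a, the Ramsey property, applied
    repeatedly, shows that finitely many conditions "g preserves the
    quantifier-free type of a tuple i" and "a finite colouring takes the same
    value on g(i) and g(j)", for i and j of the same quantifier-free type, are
    met by some g : I -> I; hence all of them lie in an ultrafilter U.  The
    U-limits of the values of formulas at a(g(i)) form a complete type which,
    by saturation, is realized by some b, and b is indiscernible and locally
    based on a.

    Modeling implies Ramsey: if no C satisfies C -> (B)^A_r, compactness yields
    an r-colouring of the n-tuples of I, where n = |A|, without homogeneous
    copy of B.  The structure I with this colouring embeds in a monster model
    of the theory of generic n-ary r-coloured hypergraphs, and an indiscernible
    sequence locally based on its image yields such a copy.  For a set K of
    larger cardinality than I, this monster model is a union of a chain of
    length K^+ whose steps realize every one-step extension, so that any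
    isomorphism between small parts extends to an automorphism by back and
    forth. *)

From HB Require Import structures.
Require Import Defs.
From mathcomp Require Import all_boot all_order all_algebra.
From mathcomp Require Import boolp classical_sets functions.
From mathcomp Require Import wochoice cardinality reals topology normedtype.
From mathcomp Require Import lra.

Set Implicit Arguments.
Unset Strict Implicit.
Unset Printing Implicit Defensive.

Import Order.TTheory GRing.Theory Num.Theory.
Import numFieldNormedType.Exports.

Local Open Scope classical_set_scope.
Local Open Scope card_scope.
Local Open Scope ring_scope.

(** * Cardinals and well-orders *)

(** The modeling property can be invoked only in a structure that is saturated and strongly
    homogeneous for an uncountable [K], so such a structure must be produced for a colouring of an
    arbitrary [I]. Since [monster_model] puts no bound on the size of the model, bookkeeping of
    extension problems is avoided: a point of level [xi] is literally a code for an extension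
    problem over everything below [xi], and distinct problems get disjoint sets of new points
    because codes are injective. The length [K^+] is chosen for its regularity: a part of size at
    most [K] lies below some level. Saturation is then reduced to homogeneity: an ultrafilter fixes
    the equalities and colours of the sought tuple, and automorphisms transfer the values of all
    formulas, quantified ones included.

    In the other direction formulas have a continuum of values and existential statements hold only
    approximately. Values are therefore sorted into finitely many cells, as fine as the desired [e]
    requires, and the conditions handed to saturation are relaxed by arbitrarily small positive
    amounts. *)

Lemma card_le_inj (T U : Type) (A : set T) (B : set U) (f : T -> U) :
  (forall x, A x -> B (f x)) ->
  (forall x y, A x -> A y -> f x = f y -> x = y) -> A #<= B.
Proof.
move=> fAB fi; have [|g] := (@injfunPex T U A B).2; last exact: inj_card_le.
exists f => // x y; rewrite !inE => Ax Ay; exact: fi.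
Qed.

Lemma inj_of_card_le (T U : Type) (A : set T) (B : set U) :
  A #<= B -> A !=set0 -> exists f : T -> U,
  (forall x, A x -> B (f x)) /\ forall x y, A x -> A y -> f x = f y -> x = y.
Proof.
move=> /card_leP[f] [x0 Ax0].
exists (fun x => if pselect (A x) is left Ax then val (f (SigSub (mem_set Ax)))
  else val (f (SigSub (mem_set Ax0)))); split=> [x Ax|x y Ax Ay].
  by case: pselect => // ?; apply/set_mem/valP.
case: pselect => // Ax'; case: pselect => // Ay' /val_inj e.
have /(congr1 val)/= : SigSub (mem_set Ax') = SigSub (mem_set Ay') :> A.
  by apply: (@inj _ _ _ f); rewrite ?inE.
by [].
Qed.

Lemma card_le_setTP (T U : Type) :
  [set: T] #<= [set: U] <-> exists f : T -> U, injective f.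
Proof.
split=> [TU|[f fi]]; last by apply: (card_le_inj (f := f)) => // x y _ _; exact: fi.
have [[t _]|/set0P/negP/negPn/eqP T0] := pselect ([set: T] !=set0); last first.
  have E (x : T) : False by move: T0 => /seteqP[/(_ x Logic.I)].
  by exists (fun x => False_rect U (E x)) => x; case: (E x).
have [|f [_ fi]] := inj_of_card_le TU; first by exists t.
by exists f => x y; exact: fi.
Qed.

Lemma card_le_setX (T T' U U' : Type) (A : set T) (B : set U) (A' : set T')
    (B' : set U') : A #<= B -> A' #<= B' -> A `*` A' #<= B `*` B'.
Proof.
move=> AB AB'.
have [[[x x'] [/= Ax Ax']]|/set0P/negP/negPn/eqP ->] :=
  pselect (A `*` A' !=set0); last exact: card_ge0.
have [|f [fAB fi]] := inj_of_card_le AB; first by exists x.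
have [|g [gAB gi]] := inj_of_card_le AB'; first by exists x'.
apply: (card_le_inj (f := fun p => (f p.1, g p.2))).
  by move=> [a b] [/= Aa Ab]; split; [exact: fAB|exact: gAB].
by move=> [a b] [c d] [/= ? ?] [/= ? ?] [/fi -> // /gi ->].
Qed.

(** Hilbert's hotel: along a sequence [f] in [A], each [f k] moves to [f k.+1] and a new point [m]
    takes the place of [f 0]. *)
Lemma card_le_setU1 (T : Type) (A : set T) (m : T) :
  infinite_set A -> A `|` [set m] #<= A.
Proof.
move=> /infiniteP/inj_of_card_le[|f [fA fi]]; first by exists 0%N.
pose h x := if pselect (x = m /\ ~ A m) then f 0%N else
  if pselect (exists k, x = f k) is left e then f (projT1 (cid e)).+1 else x.
have hm : ~ A m -> h m = f 0%N by move=> ?; rewrite /h; case: pselect => // -[].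
have hf k : h (f k) = f k.+1.
  rewrite /h; case: pselect => [[fkm nA]|?] /=; first by case: nA; rewrite -fkm;
    exact: fA.
  case: pselect => [e|]; last by case; exists k.
  by congr (f _.+1); apply: fi => //; case: cid.
have hx x : A x -> ~ (exists k, x = f k) -> h x = x.
  move=> Ax nf; rewrite /h; case: pselect => [[xm]|?] /=; first by rewrite -xm.
  by case: pselect.
apply: (card_le_inj (f := h)).
  move=> x; have [Ax _|nA [//|/= xm]] := pselect (A x).
    have [[k ->]|nf] := pselect (exists k, x = f k); first by rewrite hf; exact: fA.
    by rewrite hx.
  by move: nA; rewrite xm => /hm ->; exact: fA.
have dich x : (A `|` [set m]) x -> [\/ x = m /\ ~ A m, exists k, x = f k |
    A x /\ ~ exists k, x = f k].
  have [Ax _|nA [//|/= <-]] := pselect (A x); last by constructor 1.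
  by have [?|?] := pselect (exists k, x = f k); [constructor 2|constructor 3].
have hcase x y : (A `|` [set m]) x -> (A `|` [set m]) y -> h x = h y ->
    [\/ x = m /\ ~ A m, exists k, x = f k | A x /\ ~ exists k, x = f k] -> x = y.
  move=> /dich + /dich.
  case=> [[-> nA]|[k ->]|[Ax nx]]; case=> [[-> nA']|[l ->]|[Ay ny]];
    rewrite ?hm // ?hf ?(hx x) // ?(hx y) //.
  - by move=> /fi e; have := e I I.
  - by move=> e; case: ny; exists 0%N.
  - by move=> /fi e; have := e I I.
  - by move=> /fi e _; have [->] := e I I.
  - by move=> e; case: ny; exists k.+1.
  - by move=> e; case: nx; exists 0%N.
  - by move=> e; case: nx; exists l.+1.
by move=> x y Ax Ay e; apply: hcase => //; exact: dich.
Qed.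

Record strict_wo (T : Type) (lt : T -> T -> Prop) := StrictWo {
  swo_trans : forall y x z, lt x y -> lt y z -> lt x z;
  swo_tri : forall x y, [\/ lt x y, x = y | lt y x];
  swo_wf : well_founded lt }.

Lemma well_founded_min (T : Type) (lt : T -> T -> Prop) :
  (forall A : set T, A !=set0 -> exists x, A x /\ forall y, A y -> ~ lt y x) ->
  well_founded lt.
Proof.
move=> min x; apply: contrapT => nx.
have [|y [ny ymin]] := min [set y | ~ Acc lt y]; first by exists x.
by apply: ny; constructor => z zy; apply: contrapT => /ymin; exact.
Qed.

Lemma strict_wo_min (T : Type) (lt : T -> T -> Prop) : strict_wo lt ->
  forall A : set T, A !=set0 -> exists x, A x /\ forall y, A y -> ~ lt y x.
Proof.
move=> wo A [x Ax]; apply: contrapT => nmin.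
elim/(well_founded_ind (swo_wf wo)): x Ax => x IH Ax.
by apply: nmin; exists x; split=> // y Ay /IH; exact.
Qed.

Lemma strict_wo_irr (T : Type) (lt : T -> T -> Prop) : strict_wo lt ->
  forall x, ~ lt x x.
Proof.
by move=> wo x; elim/(well_founded_ind (swo_wf wo)): x => x IH xx; exact: (IH x).
Qed.

(** The principle only supplies a unique least element for every nonempty predicate; the order
    axioms are read off from sets of one, two and three elements. *)
Lemma strict_wo_exists (T : Type) : exists lt : T -> T -> Prop, strict_wo lt.
Proof.
have [R woR] := well_ordering_principle {classic T}.
have mem1 x y : nonempty [pred z : {classic T} | (z == x) || (z == y)].
  by exists x; rewrite inE eqxx.
have Rxx x : R x x.
  have [z [[zx zl] _]] := woR _ (mem1 x x).
  have /eqP ez : z == x by move: zx; rewrite inE orbb.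
  by rewrite -{1}ez; apply: zl; rewrite inE eqxx.
have Rtot x y : R x y \/ R y x.
  have [z [[zx zl] _]] := woR _ (mem1 x y).
  move: zx; rewrite inE => /orP[] /eqP ez.
    by left; rewrite -{1}ez; apply: zl; rewrite inE eqxx orbT.
  by right; rewrite -{1}ez; apply: zl; rewrite inE eqxx.
have Ranti x y : R x y -> R y x -> x = y.
  move=> xy yx; have [z [_ zu]] := woR _ (mem1 x y).
  have zxy (u : T) : (u = x \/ u = y) -> z = u.
    case=> ->; apply: zu; split; rewrite ?inE ?eqxx ?orbT // => w.
      by rewrite inE => /orP[/eqP ->|/eqP ->]; rewrite ?Rxx.
    by rewrite inE => /orP[/eqP ->|/eqP ->]; rewrite ?Rxx.
  by transitivity z; [apply/esym/zxy; left|apply: zxy; right].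
have Rmin (A : set T) : A !=set0 -> exists x, A x /\ forall y, A y -> R x y.
  move=> [a Aa]; have [|x [[Ax xl] _]] := woR [pred x : {classic T} | `[<A x>]].
    by exists a; apply/asboolP.
  by exists x; split=> [|y Ay]; [exact/asboolP|apply: xl; exact/asboolP].
have Rtrans y x z : R x y -> R y z -> R x z.
  move=> xy yz; have [|w [[[->|->]|->] wl]] := Rmin [set u | (u = x \/ u = y) \/ u = z].
  - by exists x; left; left.
  - by apply: wl; right.
  - by rewrite (Ranti _ _ xy (wl _ _)) //; left; left.
  - by rewrite -(Ranti _ _ yz (wl _ _)) //; left; right.
exists (fun x y => R x y /\ x <> y); split.
- move=> y x z [xy nxy] [yz nyz]; split; first exact: Rtrans xy yz.
  by move=> xz; apply: nxy; apply: Ranti => //; rewrite xz.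
- move=> x y; have [->|nxy] := pselect (x = y); first by constructor 2.
  by have [?|?] := Rtot x y; [constructor 1|constructor 3; split=> // /esym].
- apply: well_founded_min => A /Rmin[x [Ax xl]]; exists x; split=> // y Ay [yx nyx].
  by apply: nyx; apply: Ranti => //; exact: xl.
Qed.

Definition pick_in (T : Type) (x0 : T) (A : set T) : T :=
  if pselect (exists z, A z) is left e then projT1 (cid e) else x0.

Lemma pick_inP (T : Type) (x0 : T) (A : set T) :
  (exists z, A z) -> A (pick_in x0 A).
Proof. by rewrite /pick_in; case: pselect => // e _; case: cid. Qed.

(** Hessenberg's theorem by induction on [t]. If a shorter segment is as large as that of [t], the
    induction hypothesis for it suffices. Otherwise an injection is chosen greedily along an order
    of pairs: were all values used up before [p], the segment of [t] would be no larger than a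
    square built on a shorter segment. *)
Lemma card_le_square_seg (T : Type) (lt : T -> T -> Prop) : strict_wo lt ->
  forall t : T, infinite_set [set x | lt x t] ->
  [set x | lt x t] `*` [set x | lt x t] #<= [set x | lt x t].
Proof.
move=> wo t; pose S t := [set x | lt x t]; rewrite -/(S t).
elim/(well_founded_ind (swo_wf wo)): t => t IH inf.
have [[s [st le]]|nle] := pselect (exists s, lt s t /\ S t #<= S s).
  have infs : infinite_set (S s) by apply: contra_not inf; exact: card_le_finite.
  apply: card_le_trans (card_le_setX le le) _.
  apply: card_le_trans (IH s st infs) _.
  by apply: subset_card_le => x /= xs; exact: swo_trans wo _ _ _ xs st.
have [ltp wop] := strict_wo_exists (T * T).
pose mx (p : T * T) := if pselect (lt p.1 p.2) then p.2 else p.1.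
have mx1 p : lt p.1 (mx p) \/ p.1 = mx p.
  by rewrite /mx; case: pselect => //; [left|right].
have mx2 p : lt p.2 (mx p) \/ p.2 = mx p.
  by rewrite /mx; case: pselect => n; [right|case: (swo_tri wo p.1 p.2) => //; auto].
have mxS p : (S t `*` S t) p -> lt (mx p) t.
  by move=> [? ?]; rewrite /mx; case: pselect.
(* Goedel's ordering of pairs: each proper initial segment lies in a square
   of smaller cardinality. *)
pose prec q p := lt (mx q) (mx p) \/ (mx q = mx p /\ ltp q p).
have wfp : well_founded prec.
  apply: well_founded_min => A [a Aa].
  have [|m [[p Ap <-] pmin]] := strict_wo_min wo (A := mx @` A).
    by exists (mx a); exists a.
  have [|q [[Aq qp] qmin]] := strict_wo_min wop (A := A `&` [set q | mx q = mx p]).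
    by exists p.
  exists q; split=> // r Ar [|[rq]]; first by rewrite qp; apply: pmin; exists r.
  by apply: qmin; split=> //=; rewrite rq.
have tot p q : p <> q -> prec p q \/ prec q p.
  move=> npq; case: (swo_tri wo (mx p) (mx q)) => [?|e|?]; rewrite /prec; auto.
  by case: (swo_tri wop p q); auto.
pose F p (rec : forall q, prec q p -> T) : T :=
  pick_in p.1 [set z | S t z /\ forall q (h : prec q p), (S t `*` S t) q ->
    rec q h <> z].
pose f := Fix wfp (fun=> T) F.
have fE p : f p = pick_in p.1 [set z | S t z /\
    forall q, prec q p -> (S t `*` S t) q -> f q <> z].
  rewrite /f Fix_eq // => x g h gh; congr F.
  by apply: functional_extensionality_dep => y;
    apply: functional_extensionality_dep => ?.
have fP p : (S t `*` S t) p ->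
    S t (f p) /\ forall q, prec q p -> (S t `*` S t) q -> f q <> f p.
  move=> Sp; rewrite [f p]fE.
  have [] // := @pick_inP _ p.1 [set z | S t z /\
    forall q, prec q p -> (S t `*` S t) q -> f q <> z].
  apply: contrapT => nz; pose C := S (mx p) `|` [set mx p].
  have SC : S t #<= C `*` C.
    apply: card_le_trans (card_image_le f (C `*` C)).
    apply: subset_card_le => z Sz; apply: contrapT => nfz; apply: nz.
    exists z; split=> // q qp Sq fqz; apply: nfz; exists q => //.
    have le x : lt x (mx q) \/ x = mx q -> C x.
      rewrite /C /S; case: qp => [qp|[<- _]] [xq|->] /=; auto.
      by left; exact: swo_trans wo _ _ _ xq qp.
    by split; apply: le.
  have [Sfin|Sinf] := pselect (finite_set (S (mx p))).
    by apply: inf; apply: card_le_finite SC _; apply: finite_setX; rewrite finite_setU.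
  apply: nle; exists (mx p); split; first exact: mxS.
  apply: card_le_trans SC _; have CS := card_le_setU1 (mx p) Sinf.
  by apply: card_le_trans (card_le_setX CS CS) _; apply: IH => //; exact: mxS.
apply: (card_le_inj (f := f)) => [p /fP[]//|p q Sp Sq fpq].
apply: contrapT => /tot[pq|qp]; first by have [_ /(_ p pq Sp)] := fP q Sq.
by have [_ /(_ q qp Sq)] := fP p Sp; apply.
Qed.

(** The new top [None] makes all of [T] a proper initial segment, to which [card_le_square_seg]
    applies. *)
Lemma strict_wo_option (T : Type) (lt : T -> T -> Prop) : strict_wo lt ->
  strict_wo (fun x y : option T => match x, y with
    | Some a, Some b => lt a b | Some _, None => True | None, _ => False end).
Proof.
move=> wo; split.
- by move=> [y|] [x|] [z|] //; exact: swo_trans.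
- move=> [x|] [y|].
  + by case: (swo_tri wo x y) => [|->|]; [constructor 1|constructor 2|constructor 3].
  + by constructor 1.
  + by constructor 3.
  + by constructor 2.
- have accS x : Acc (fun x y : option T => match x, y with
    | Some a, Some b => lt a b | Some _, None => True | None, _ => False end) (Some x).
    move: x; refine (well_founded_ind (swo_wf wo) _ _) => x IH.
    by apply: Acc_intro => -[y yx|[]]; exact: IH.
  by case=> [x|]; [exact: accS|apply: Acc_intro => -[y _|[]]; exact: accS].
Qed.

Lemma card_le_square (T : Type) :
  infinite_set [set: T] -> [set: T * T] #<= [set: T].
Proof.
move=> infT; have [lt wo] := strict_wo_exists T.
have := card_le_square_seg (strict_wo_option wo) (t := None).
set S := (X in infinite_set X -> _) => sq.
have TS : [set: T] #<= S by apply: (card_le_inj (f := Some)) => // x y _ _ [].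
have infS : infinite_set S by apply: contra_not infT; exact: card_le_finite.
have [x0 _] := infinite_setN0 infT.
have [|f [fS fi]] := inj_of_card_le (sq infS); first by exists (Some x0, Some x0).
apply: (@card_le_trans _ (option T) _ S).
  apply: (card_le_inj (f := fun p => f (Some p.1, Some p.2))) => [p _|];
    first exact: fS.
  by move=> [a b] [c d] _ _ /fi e;
    have [-> ->] := e (conj Logic.I Logic.I) (conj Logic.I Logic.I).
apply: (card_le_inj (f := odflt x0)) => // -[a|] [b|] //= _ _ -> //.
Qed.

Lemma card_le_option (T : Type) :
  infinite_set [set: T] -> [set: option T] #<= [set: T].
Proof.
move=> infT.
have someT : range (@Some T) #<= [set: T] by exact: card_image_le.
apply: card_le_trans someT; apply: card_le_trans (card_le_setU1 None _).
  by apply: subset_card_le => -[x|] _; [left; exists x|right].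
apply: contra_not infT; apply: card_le_finite.
by apply: (card_le_inj (f := Some)) => [x _|x y _ _ []]; first by exists x.
Qed.

Lemma card_le_total (T U : Type) : [set: T] #<= [set: U] \/ [set: U] #<= [set: T].
Proof.
pose P (G : set (T * U)) :=
  forall x x' y y', G (x, y) -> G (x', y') -> x = x' <-> y = y'.
have [|G [PG Gmax]] := @Zorn_bigcup (T * U) P.
  move=> F FP Ftot x x' y y' [A FA Axy] [B FB Bxy'].
  by have [AB|BA] := Ftot A B FA FB; [apply: (FP B)|apply: (FP A)]; auto.
have [domG|/existsNP[x nx]] := pselect (forall x, exists y, G (x, y)).
  left; have [f fG] := choice domG; apply/card_le_setTP; exists f => x x' e.
  by apply/(PG _ _ _ _ (fG x) (fG x')).
have [ranG|/existsNP[y ny]] := pselect (forall y, exists x, G (x, y)).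
  right; have [f fG] := choice ranG; apply/card_le_setTP; exists f => y y' e.
  by apply/(PG _ _ _ _ (fG y) (fG y')).
case: (Gmax (G `|` [set (x, y)])).
  by split; [exact: subsetUl|move=> /(_ (x, y)) Gxy; apply: nx; exists y; apply: Gxy;
    right].
move=> a a' b b' [Gab|[-> ->]] [Gab'|[-> ->]] //; first exact: PG.
  by split=> e; [case: nx; exists b; rewrite -e|case: ny; exists a; rewrite -e].
by split=> e; [case: nx; exists b'; rewrite e|case: ny; exists a'; rewrite e].
Qed.

Lemma card_lt_prod (I J K : Type) : card_lt [set: nat] [set: K] ->
  card_lt [set: I] [set: K] -> card_lt [set: J] [set: K] ->
  card_lt [set: I * J] [set: K].
Proof.
(* [S] stands for the largest of [nat], [I] and [J]; it is infinite and absorbs the product. *)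
suff wlog S : card_lt [set: S] [set: K] -> [set: nat] #<= [set: S] ->
    [set: I] #<= [set: S] -> [set: J] #<= [set: S] -> card_lt [set: I * J] [set: K].
  move=> ltN ltI ltJ.
  have [IJ|JI] := card_le_total I J.
    have [NJ|JN] := card_le_total nat J; first exact: (wlog J).
    by apply: (wlog nat) => //; exact: card_le_trans IJ JN.
  have [NI|IN] := card_le_total nat I; first exact: (wlog I).
  by apply: (wlog nat) => //; exact: card_le_trans JI IN.
move=> [SK nKS] NS IS JS.
have IJS : [set: I * J] #<= [set: S].
  rewrite -setXTT; apply: card_le_trans (card_le_setX IS JS) _.
  by rewrite setXTT; apply: card_le_square; exact/infiniteP.
split; first exact: card_le_trans SK.
by move=> KIJ; apply: nKS; exact: card_le_trans IJS.
Qed.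

Lemma card_lt_powerset (T : Type) : card_lt [set: T] [set: set T].
Proof.
split.
  by apply: (card_le_inj (f := @set1 T)) => // x y _ _ /seteqP[/(_ x erefl)].
move=> /card_le_setTP[f fi]; pose D := [set x | exists2 A, f A = x & ~ A x].
have [DfD|nDfD] := pselect (D (f D)); last by apply: (nDfD); exists D.
by case: (DfD) => A /fi -> nD; exact: nD.
Qed.

(** [D] is the ordinal [K^+] inside a well-order of [set K]; by Cantor's theorem it is larger than
    [K]. An unbounded [h] would cover [D] by [K] many segments of size at most [K], whence [D] would
    have size at most that of [K] squared. *)
Lemma regular_successor (K : Type) : infinite_set [set: K] ->
  exists (Lam : Type) (lt : Lam -> Lam -> Prop), [/\ strict_wo lt, inhabited Lam
    & forall h : K -> Lam, exists l, forall k, lt (h k) l].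
Proof.
move=> infK; have [lt wo] := strict_wo_exists (set K).
pose D := [set x | [set y | lt y x] #<= [set: K]].
pose ltD (x y : {x | D x}) := lt (sval x) (sval y).
have D_big : ~ (D #<= [set: K]).
  move=> DK; have [[t nDt]|allD] := pselect (exists t, ~ D t).
    have [|t' [nD tmin]] := strict_wo_min wo (A := ~` D); first by exists t.
    apply: nD; apply: card_le_trans DK; apply: subset_card_le => y /= yt.
    by apply: contrapT => /tmin; exact.
  apply: (card_lt_powerset K).2; apply: card_le_trans DK.
  by apply: subset_card_le => x _; apply: contrapT => nDx; apply: allD; exists x.
exists {x | D x}, ltD; split.
  split=> [y x z xy yz||].
  - exact: (swo_trans wo xy yz).
  - move=> [x Dx] [y Dy]; case: (swo_tri wo x y) => [?|e|?].
    + by constructor 1.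
    + by constructor 2; move: e => /= e; move: Dx; rewrite e => Dx; congr exist;
        exact: Prop_irrelevance.
    + by constructor 3.
  - apply: well_founded_min => A [x Ax].
    have [|_ [[m Am <-] mmin]] := strict_wo_min wo (A := sval @` A).
      by exists (sval x); exists x.
    by exists m; split=> // y Ay; apply: mmin; exists y.
  apply: contrapT => nD; apply: D_big; rewrite (_ : D = set0) //.
  by apply/seteqP; split=> // x Dx; apply: nD; split; exists x.
move=> h; apply: contrapT => nbd; apply: D_big.
have cof x : D x -> exists k, lt x (sval (h k)) \/ x = sval (h k).
  move=> Dx; apply: contrapT => nk; apply: nbd; exists (exist _ x Dx) => k.
  by case: (swo_tri wo (sval (h k)) x) => // ?; case: nk; exists k; auto.
have [k0 _] := infinite_setN0 infK.
have /choice[kx kxP] : forall x, exists k, D x -> lt x (sval (h k)) \/ x = sval (h k).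
  move=> x; have [Dx|nDx] := pselect (D x); last by exists k0.
  by have [k ?] := cof x Dx; exists k.
have /choice[e eP] : forall k, exists e : set K -> K, forall x y,
    lt x (sval (h k)) -> lt y (sval (h k)) -> e x = e y -> x = y.
  move=> k; have [[x xk]|nx] := pselect ([set x | lt x (sval (h k))] !=set0).
    have [|e [_ ei]] := inj_of_card_le (svalP (h k) : _ #<= _); first by exists x.
    by exists e => a b ak bk; exact: ei.
  by exists (fun=> k0) => x y xk; case: nx; exists x.
apply: (@card_le_trans _ _ _ ([set: K] `*` [set: option K])); last first.
  apply: card_le_trans (card_le_setX (card_lexx _) (card_le_option infK)) _.
  by rewrite setXTT; exact: card_le_square.
(* The value [None] codes the end point [h k] itself, which lies outside its own segment. *)
apply: (card_le_inj (f := fun x => (kx x,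
  if pselect (lt x (sval (h (kx x)))) then Some (e (kx x) x) else None))) => //.
move=> x y Dx Dy [exy]; rewrite -exy.
case: pselect => ltx; case: pselect => lty //=; first by move=> []; exact: eP.
by move=> _; have [//|->] := kxP x Dx; have [|->] := kxP y Dy; rewrite -exy.
Qed.

(** * A tower of coloured hypergraphs *)

Lemma existT_inj (T : Type) (P : T -> Type) (x : T) (a b : P x) :
  existT P x a = existT P x b -> a = b.
Proof.
by move=> e; have := projT2_eq e; rewrite (Prop_irrelevance (projT1_eq e) erefl).
Qed.

Section Tower.
Variables (Lam : Type) (lt : Lam -> Lam -> Prop) (wo : strict_wo lt).
Variables (W C : Type) (n : nat).

(** A point of a new level over [X] carries its whole extension problem: the prescribed colouring,
    the part identified with old points, and its own label. [tc_pt] is optional because [new] also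
    accepts labels that do not lie below its level. *)
Record tcode (X : Type) := TCode {
  tc_col : ('I_n -> X + W) -> C;
  tc_map : X + W -> option X;
  tc_pt : option (X + W) }.

Definition level : Lam -> Type :=
  Fix (swo_wf wo) (fun=> Type)
    (fun xi rec => tcode {e : {eta | lt eta xi} & rec (sval e) (svalP e)}).

Definition below (xi : Lam) := {e : {eta | lt eta xi} & level (sval e)}.

Lemma levelE xi : tcode (below xi) = level xi.
Proof.
rewrite [RHS]/level Fix_eq // => x g h gh; congr tcode.
suff -> : g = h by [].
by apply: functional_extensionality_dep => y; apply: functional_extensionality_dep => ?.
Qed.

Let M := {xi & level xi}.

Definition castT (A B : Type) (e : A = B) : A -> B :=
  match e in _ = T return A -> T with erefl => id end.

Lemma castT_inj (A B : Type) (e : A = B) : injective (castT e).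
Proof. by case: B / e. Qed.

Let up1 xi (e : below xi) : M := existT _ (sval (projT1 e)) (projT2 e).

Let up xi (v : below xi + W) : M + W :=
  match v with inl e => inl (up1 e) | inr w => inr w end.

Let down xi (x : M) : option (below xi) :=
  if pselect (lt (projT1 x) xi) is left h then
    Some (existT (fun e : {eta | lt eta xi} => level (sval e))
            (exist _ (projT1 x) h) (projT2 x))
  else None.

Let ok xi (v : M + W) : Prop := if v is inl x then lt (projT1 x) xi else True.

Let upP xi v : ok xi v -> exists u : below xi + W, up u = v.
Proof.
case: v => [[eta x] /= h|w _]; last by exists (inr w).
by exists (inl (existT (fun e : {eta | lt eta xi} =>
  level (sval e)) (exist _ eta h) x)).
Qed.

Let downE xi x : lt (projT1 x) xi ->
  exists2 e : below xi, down xi x = Some e & up1 e = x.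
Proof.
rewrite /down; case: pselect => // h _; eexists; first by [].
by case: x h.
Qed.

Let downK xi x (e : below xi) : down xi x = Some e -> up1 e = x.
Proof. by rewrite /down; case: pselect => // h [<-]; case: x h. Qed.

Let new xi (Q : ('I_n -> M + W) -> C) (f : M + W -> option M) (y : M + W) : M :=
  existT _ xi (castT (levelE xi) (TCode (fun z => Q (fun k => up (z k)))
    (fun v => obind (down xi) (f (up v)))
    (match y with inl x => omap inl (down xi x) | inr w => Some (inr w) end))).

(* Every level contains a copy of all colourings [Q] of what precedes it plus
   a set [W], each copy having a part identified, through the partial map [f],
   with what precedes; [new xi Q f y] is the copy of the point y. *)
Lemma tower_exists : exists (M : Type) (lev : M -> Lam)
    (new : Lam -> (('I_n -> M + W) -> C) -> (M + W -> option M) -> M + W -> M),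
  let ok xi (v : M + W) := if v is inl x then lt (lev x) xi else True in
  (forall xi Q f y, lev (new xi Q f y) = xi) /\
  (forall xi Q Q' f f' y y', new xi Q f y = new xi Q' f' y' -> ok xi y ->
    [/\ y = y',
        forall v x, ok xi v -> lt (lev x) xi -> f v = Some x -> f' v = Some x
      & forall z, (forall k, ok xi (z k)) -> Q z = Q' z]).
Proof.
exists M, (@projT1 _ _), new => /=; split=> // xi Q Q' f f' y y' enew oky.
have e := castT_inj (existT_inj enew); split.
- have := congr1 (@tc_pt _) e; case: y oky {e enew} => [x oky|w _] /=.
    have [u -> <-] := downE oky; case: y' => [x'|w'] //=.
    by case e: (down xi x') => [u'|] //= [ee]; rewrite -(downK e) ee.
  case: y' => [x'|w'] /=; last by case=> ->.
  by case: (down xi x').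
- move=> v x /upP[u <-] ltx fx; have [b db bx] := downE ltx.
  have /(congr1 (@^~ u)) := congr1 (@tc_map _) e; rewrite /= fx /= db.
  by case: (f' (up u)) => //= x' /esym/downK <-; rewrite bx.
- move=> z okz; have /choice[z' z'E] k := upP (okz k).
  have := congr1 (@^~ z') (congr1 (@tc_col _) e) => /=.
  by rewrite (_ : (fun k => up (z' k)) = z) //; apply: funext.
Qed.

End Tower.

(** * The generic colouring of the tower *)

Section Generic.
Variables (Lam : Type) (lt : Lam -> Lam -> Prop) (wo : strict_wo lt).
Variables (W C : Type) (c0 : C) (n : nat) (M : Type) (lev : M -> Lam).
Variable new : Lam -> (('I_n -> M + W) -> C) -> (M + W -> option M) -> M + W -> M.

Let ok xi (v : M + W) : Prop := if v is inl x then lt (lev x) xi else True.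

Hypothesis lev_new : forall xi Q f y, lev (new xi Q f y) = xi.
Hypothesis new_inj : forall xi Q Q' f f' y y',
  new xi Q f y = new xi Q' f' y' -> ok xi y ->
  [/\ y = y',
      forall v x, ok xi v -> lt (lev x) xi -> f v = Some x -> f' v = Some x
    & forall z, (forall k, ok xi (z k)) -> Q z = Q' z].
Hypothesis nomax : forall xi, exists xi', lt xi xi'.

Definition proper_map xi (f : M + W -> option M) : Prop :=
  (forall v x, f v = Some x -> lt (lev x) xi) /\
  (forall v v' x, f v = Some x -> f v' = Some x -> v = v').

Definition node xi Q f (v : M + W) : M := if f v is Some x then x else new xi Q f v.

(** At least one coordinate must be new: from it the problem that prescribes the colour can be
    recovered. *)
Definition coloured (x : 'I_n -> M) (c : C) : Prop :=
  exists xi Q f (y : 'I_n -> M + W),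
    [/\ proper_map xi f, forall k, ok xi (y k), exists k, f (y k) = None,
        x = (fun k => node xi Q f (y k)) & Q y = c].

Definition colour (x : 'I_n -> M) : C := pick_in c0 [set c | coloured x c].

(** New coordinates lie at level [xi] exactly and old ones strictly below, so [x] determines [xi].
    Injectivity of [new] at a new coordinate then gives [Q] and [f] on what precedes [xi], and with
    them the labels [y]. *)
Lemma coloured_uniq x c c' : coloured x c -> coloured x c' -> c = c'.
Proof.
move=> [xi [Q [f [y [[fx fi] oky [k fk] xy <-]]]]].
move=> [xi' [Q' [f' [y' [[fx' fi'] oky' [k' fk'] xy' <-]]]]].
have e m : node xi Q f (y m) = node xi' Q' f' (y' m).
  exact: (congr1 (@^~ m) (etrans (esym xy) xy')).
have := e k; rewrite {1}/node fk /node.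
case f'k : (f' (y' k)) => [a|] ek.
  have le : lt xi xi' by rewrite -(lev_new xi Q f (y k)) ek; exact: fx' f'k.
  have := e k'; rewrite /node fk'; case fk'' : (f (y k')) => [b|] ek'.
    have := fx _ _ fk''; rewrite ek' lev_new => le'.
    by case: (strict_wo_irr wo (swo_trans wo le le')).
  by move: le; rewrite -(lev_new xi Q f (y k')) ek' lev_new => /(strict_wo_irr wo).
have exi : xi = xi' by rewrite -(lev_new xi Q f (y k)) ek lev_new.
case: xi' / exi in fx' oky' xy' e ek *.
have [_ ff' QQ'] := new_inj ek (oky k).
have [_ f'f _] := new_inj (esym ek) (oky' k).
suff yy' : y = y' by rewrite QQ' // yy'.
apply: funext => m; have := e m; rewrite /node.
case fm : (f (y m)) => [a|]; case f'm : (f' (y' m)) => [b|] em.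
- by have := f'f _ _ (oky' m) (fx' _ _ f'm) f'm; rewrite -em => /(fi _ _ _ fm).
- by have := fx _ _ fm; rewrite em lev_new => /(strict_wo_irr wo).
- by have := fx' _ _ f'm; rewrite -em lev_new => /(strict_wo_irr wo).
- by have [] := new_inj em (oky m).
Qed.

Lemma colourE x c : coloured x c -> colour x = c.
Proof.
move=> xc; apply: (coloured_uniq (x := x)) => //.
by apply: (@pick_inP _ c0 [set c | coloured x c]); exists c.
Qed.

(** The labelling [h] transports [S] into [M + W], where level [xi] holds a copy of every colouring.
    The copy for the transported [Q], with [D] identified through [f], is the image: tuples within
    [D] are governed by the hypothesis on [f], and all others have a new coordinate, hence the
    prescribed colour. *)
Lemma extension (S : Type) (Q : ('I_n -> S) -> C) (D : set S) (f : S -> M) xi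
    (h : S -> M + W) :
  injective h -> (forall s, ok xi (h s)) ->
  (forall s, D s -> lt (lev (f s)) xi) ->
  (forall s t, D s -> D t -> f s = f t -> s = t) ->
  (forall y, (forall k, D (y k)) -> colour (fun k => f (y k)) = Q y) ->
  exists e : S -> M, [/\ forall s, D s -> e s = f s, injective e,
    forall y, colour (fun k => e (y k)) = Q y
    & forall s xi', lt xi xi' -> lt (lev (e s)) xi'].
Proof.
move=> hi okh fD fi fQ.
have [[s0 _]|nS] := pselect (exists s : S, True); last first.
  exists f; split=> [//|s|y|s]; try by case: nS; exists s.
  by apply: fQ => k; case: nS; exists (y k).
pose hinv v := pick_in s0 [set s | h s = v].
have hK s : hinv (h s) = s.
  by apply: hi; apply: (@pick_inP _ s0 [set t | h t = h s]); exists s.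
pose f' v := if pselect (exists s, D s /\ h s = v) then Some (f (hinv v)) else None.
have f'D s : D s -> f' (h s) = Some (f s).
  by move=> Ds; rewrite /f'; case: pselect => [_|[]] /=; [rewrite hK|exists s].
have f'nD s : ~ D s -> f' (h s) = None.
  by move=> nDs; rewrite /f'; case: pselect => //= -[t [Dt /hi ts]]; rewrite ts in Dt.
have f'E v x : f' v = Some x -> exists s, [/\ D s, h s = v & f s = x].
  rewrite /f'; case: pselect => //= -[s [Ds hs]] [<-]; exists s; split=> //.
  by rewrite -hs hK.
have prop' : proper_map xi f'.
  split=> [v x /f'E[s [Ds _ <-]]|v v' x /f'E[s [Ds <- <-]] /f'E[t [Dt <-]]];
    first exact: fD.
  by move=> /esym/(fi _ _ Ds Dt) ->.
pose Q' (z : 'I_n -> M + W) := Q (fun k => hinv (z k)).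
pose e s := node xi Q' f' (h s).
have eD s : D s -> e s = f s by move=> Ds; rewrite /e /node f'D.
have enD s : ~ D s -> e s = new xi Q' f' (h s) by move=> Ds; rewrite /e /node f'nD.
exists e; split=> //.
- move=> s t; have [Ds|Ds] := pselect (D s); have [Dt|Dt] := pselect (D t);
    rewrite ?(eD _ Ds) ?(eD _ Dt) ?(enD _ Ds) ?(enD _ Dt).
  + exact: fi.
  + by move=> st; have := fD _ Ds; rewrite st lev_new => /(strict_wo_irr wo).
  + by move=> st; have := fD _ Dt; rewrite -st lev_new => /(strict_wo_irr wo).
  + by move=> e'; have [/hi] := new_inj e' (okh s).
- move=> y; have [yD|/existsNP[k nDk]] := pselect (forall k, D (y k)).
    by rewrite -fQ //; congr colour; apply: funext => k; exact: eD.
  apply: colourE; exists xi, Q', f', (fun k => h (y k)); split=> //.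
    by exists k; exact: f'nD.
  by rewrite /Q'; congr Q; apply: funext => m; rewrite hK.
- move=> s xi' ltxi; have [Ds|Ds] := pselect (D s); last by rewrite enD // lev_new.
  by rewrite eD //; exact: (swo_trans wo (fD _ Ds) ltxi).
Qed.

(** * Back and forth along the levels *)

Definition partial_iso (p : set (M * M)) : Prop :=
  (forall a b, p a -> p b -> a.1 = b.1 <-> a.2 = b.2) /\
  (forall z : 'I_n -> M * M, (forall k, p (z k)) ->
     colour (fun k => (z k).1) = colour (fun k => (z k).2)).

Definition bounded_by (p : set (M * M)) xi : Prop :=
  forall a, p a -> lt (lev a.1) xi /\ lt (lev a.2) xi.

Definition swap (p : set (M * M)) : set (M * M) := [set a | p (a.2, a.1)].

Lemma partial_iso_swap p : partial_iso p -> partial_iso (swap p).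
Proof.
move=> [pf pc]; split=> [a b pa pb|z zp].
  by have := pf _ _ pa pb => /=; tauto.
by rewrite (pc (fun k => ((z k).2, (z k).1))).
Qed.

Lemma bounded_by_swap p xi : bounded_by p xi -> bounded_by (swap p) xi.
Proof. by move=> bp a /bp[]. Qed.

(** All points below [xi] are added to the domain in a single step: they form one extension problem,
    coloured by [colour] itself and labelled by themselves, in which the domain of [p] is already
    placed. *)
Lemma partial_iso_forth p xi xi' : partial_iso p -> bounded_by p xi -> lt xi xi' ->
  exists p', [/\ p `<=` p', partial_iso p', bounded_by p' xi'
    & forall x, lt (lev x) xi -> exists y, p' (x, y)].
Proof.
move=> [pf pc] bp ltxi.
pose S := {x : M | lt (lev x) xi}; pose D (s : S) := exists y, p (sval s, y).
have /choice[f fP] : forall s : S, exists y, D s -> p (sval s, y).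
  move=> s; have [[y py]|nD] := pselect (D s); first by exists y.
  by exists (sval s) => /nD.
have sval_i : injective (sval : S -> M).
  by move=> [x hx] [y hy] /= e; move: hx hy; rewrite e => hx hy; congr exist;
    exact: Prop_irrelevance.
have [|||s t Ds Dt fst||e [ef ei ec el]] :=
  @extension S (fun y => colour (fun k => sval (y k)))
    D f xi (fun s => inl (sval s)).
- by move=> s t [] /sval_i.
- by move=> s; exact: (proj2_sig s).
- by move=> s Ds; have [] := bp _ (fP s Ds).
- by apply: sval_i; have [_] := pf _ _ (fP _ Ds) (fP _ Dt); apply.
- by move=> y yD; rewrite -(pc (fun k => (sval (y k), f (y k)))) // => k; exact: fP.
exists (range (fun s => (sval s, e s))); split.
- move=> [x y] pxy; have [ltx _] := bp _ pxy.
  have Ds : D (exist _ x ltx) by exists y.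
  exists (exist _ x ltx) => //=; congr (_, _); rewrite ef //.
  by apply/(pf _ _ (fP _ Ds) pxy).
- split=> [_ _ [s _ <-] [t _ <-] /=|z zp].
    by split=> [/sval_i ->|/ei ->].
  have /choice[s sz] : forall k, exists s : S, (sval s, e s) = z k.
    by move=> k; have [s _ <-] := zp k; exists s.
  transitivity (colour (fun k => sval (s k))).
    by congr colour; apply: funext => k; rewrite -sz.
  by rewrite -ec; congr colour; apply: funext => k; rewrite -sz.
- move=> _ [s _ <-] /=; split; last exact: el.
  exact: (swo_trans wo (svalP s) ltxi).
- by move=> x ltx; exists (e (exist _ x ltx)); exists (exist _ x ltx).
Qed.

Definition dense_in (p : set (M * M)) xi : Prop := forall x, lt (lev x) xi ->
  (exists y, p (x, y)) /\ (exists y, p (y, x)).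

Lemma partial_iso_back_forth p xi : partial_iso p -> bounded_by p xi ->
  exists p' xi', [/\ p `<=` p', partial_iso p', bounded_by p' xi' & dense_in p' xi].
Proof.
move=> isop bp; have [xi1 lt1] := nomax xi; have [xi2 lt2] := nomax xi1.
have [q [pq isoq bq dq]] := partial_iso_forth isop bp lt1.
have [r [qr isor br dr]] :=
  partial_iso_forth (partial_iso_swap isoq) (bounded_by_swap bq) lt2.
exists (swap r), xi2; split.
- by move=> [x y] /pq qxy; exact: (qr (y, x) qxy).
- exact: partial_iso_swap.
- exact: bounded_by_swap.
- move=> x ltx; split; last by apply: dr; exact: (swo_trans wo ltx lt1).
  by have [y qxy] := dq x ltx; exists y; exact: (qr (y, x) qxy).
Qed.

Lemma chain_tuple (T : Type) (F : set (set T)) m (z : 'I_m -> T) :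
  total_on F subset -> F !=set0 -> (forall k, (\bigcup_(A in F) A) (z k)) ->
  exists2 A, F A & forall k, A (z k).
Proof.
move=> Ftot [A0 FA0]; elim: m z => [|m IH] z zF; first by exists A0 => // -[].
have [A FA Az] := IH (fun k => z (lift ord0 k)) (fun k => zF _).
have [B FB Bz] := zF ord0.
have [AB|BA] := Ftot A B FA FB.
  by exists B => // k; case: (unliftP ord0 k) => [j ->|-> //]; exact: AB.
by exists A => // k; case: (unliftP ord0 k) => [j -> //|->]; exact: BA.
Qed.

Lemma homogeneity p0 xi0 : partial_iso p0 -> bounded_by p0 xi0 ->
  exists g : M -> M, [/\ bijective g, forall a, p0 a -> g a.1 = a.2
    & forall x : 'I_n -> M, colour (g \o x) = colour x].
Proof.
move=> iso0 b0; pose total p := forall xi, dense_in p xi.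
pose T := {p | [/\ partial_iso p, p0 `<=` p & (exists xi, bounded_by p xi) \/ total p]}.
(* A strict increase must exhaust a level that bounds the smaller map, so
   that the union of a chain without a last element is bounded or total. *)
pose R (p q : set (M * M)) := p = q \/
  exists xi, [/\ bounded_by p xi, p `<=` q & dense_in q xi].
have Rsub p q : R p q -> p `<=` q by case=> [->//|[xi []]].
have mono p q xi : p `<=` q -> dense_in p xi -> dense_in q xi.
  move=> pq dp x /dp[[y ?] [z ?]].
  by split; [exists y; exact: pq|exists z; exact: pq].
have [||||[p [isop sub0 bp]] pmax] := @Zorn T (fun s t => `[<R (sval s) (sval t)>]).
- by move=> t; apply/asboolP; left.
- move=> [r _] [s _] [t _] /asboolP/= rs /asboolP/= st; apply/asboolP => /=.
  case: rs => [->//|[xi [br rs ds]]]; right; exists xi.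
  by split=> //; [exact: subset_trans rs (Rsub _ _ st)|exact: mono (Rsub _ _ st) ds].
- move=> [s hs] [t ht] /asboolP/Rsub/= st /asboolP/Rsub/= ts.
  have e : s = t by apply/seteqP.
  by move: hs ht {st ts}; rewrite e => hs ht; congr exist; exact: Prop_irrelevance.
- move=> A Atot.
  have [[t0 At0]|A0] := pselect (exists t, A t); last first.
    have h0 : [/\ partial_iso p0, p0 `<=` p0 & (exists xi, bounded_by p0 xi) \/ total
      p0].
      by split=> //; left; exists xi0.
    by exists (exist _ p0 h0) => s As; case: A0; exists s.
  have [[t [At tmax]]|nomaxA] :=
    pselect (exists t, A t /\ forall s, A s -> R (sval s) (sval t)).
    by exists t => s As; apply/asboolP; exact: tmax.
  have next t : A t -> exists s xi, [/\ A s, bounded_by (sval t) xi,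
      sval t `<=` sval s & dense_in (sval s) xi].
    move=> At; apply: contrapT => ns; apply: nomaxA; exists t; split=> // s As.
    have [/asboolP//|/asboolP/=] := Atot s t As At.
    case=> [->|[xi [? ? ?]]]; first by left.
    by case: ns; exists s, xi.
  pose u := \bigcup_(a in [set sval t | t in A]) a.
  have subu t : A t -> sval t `<=` u by move=> At a ta; exists (sval t) => //; exists t.
  have ctot : total_on [set sval t | t in A] subset.
    by move=> _ _ [s As <-] [t At <-];
      have [/asboolP/Rsub|/asboolP/Rsub] := Atot s t As At; auto.
  have cn0 : [set sval t | t in A] !=set0 by exists (sval t0); exists t0.
  have hu : [/\ partial_iso u, p0 `<=` u & (exists xi, bounded_by u xi) \/ total u].
    split.
    - split=> [a b ua ub|z uz].
        have [|_ [s As <-] sz] := chain_tuple (z :=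
          fun k : 'I_2 => if k == ord0 then a else b) ctot cn0.
          by move=> k; case: ifP.
        have [[sf _] _ _] := svalP s.
        exact: sf (sz ord0) (sz ord_max).
      have [_ [s As <-] sz] := chain_tuple ctot cn0 uz.
      by have [[_ sc] _ _] := svalP s; exact: sc.
    - by have [_ sub _] := svalP t0; exact: subset_trans sub (subu _ At0).
    - have [?|nb] := pselect (exists xi, bounded_by u xi); [by left|right].
      (* As the union is unbounded, some [t] in the chain reaches level [xi]. Any [zeta] bounding
         [t] lies above [lev x], and the successor of [t] in the chain is dense below [zeta]. *)
      move=> xi x ltx; have [t [a [At ta nlt]]] : exists t a, [/\ A t, sval t a
          & ~ (lt (lev a.1) xi /\ lt (lev a.2) xi)].
        apply: contrapT => nt; apply: nb; exists xi => a [_ [t At <-] ta].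
        by apply: contrapT => nlt; apply: nt; exists t, a.
      have [s [zeta [As bt ts ds]]] := next t At.
      apply: (mono _ _ zeta (subu s As) ds).
      case: (swo_tri wo (lev x) zeta) => // le; case: nlt; have [l1 l2] := bt _ ta.
        by rewrite -le in l1 l2; split;
          [exact: (swo_trans wo l1)|exact: (swo_trans wo l2)].
      by split; [exact: (swo_trans wo (swo_trans wo l1 le))|
                 exact: (swo_trans wo (swo_trans wo l2 le))].
  exists (exist _ u hu) => t At; apply/asboolP; right.
  have [s [zeta [As bt ts ds]]] := next t At.
  by exists zeta; split=> //; [exact: subu|exact: (mono _ _ _ (subu s As))].
have ptot x : (exists y, p (x, y)) /\ (exists y, p (y, x)).
  case: (bp) => [[xi bxi]|tot]; last by have [xi'] := nomax (lev x); exact: tot.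
  (* A bounded maximal map still contains every [x]: extending it past a bound [zeta] above [lev x]
     gives an [R]-larger map, which by maximality is the same map. *)
  have [zeta [ltx bz]] : exists zeta, lt (lev x) zeta /\ bounded_by p zeta.
    have [xi' lx'] := nomax (lev x); case: (swo_tri wo xi xi') => [lt'|e|lt'].
    - by exists xi'; split=> // a /bxi[l1 l2]; split;
        [exact: (swo_trans wo l1)|exact: (swo_trans wo l2)].
    - by exists xi; rewrite e in bxi *.
    - by exists xi; split=> //; exact: (swo_trans wo lx').
  have [p' [xi' [pp' iso' b' d']]] := partial_iso_back_forth isop bz.
  have h' : [/\ partial_iso p', p0 `<=` p' & (exists xi, bounded_by p' xi) \/ total p'].
    by split=> //; [exact: subset_trans pp'|left; exists xi'].
  have e : exist _ p' h' = exist _ p (And3 isop sub0 bp) :> T.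
    by apply: pmax; apply/asboolP; right; exists zeta.
  have /= <- := congr1 sval e; exact: d'.
have [pf pc] := isop.
have /choice[g gp] : forall x, exists y, p (x, y) by move=> x; have [] := ptot x.
have /choice[g' gp'] : forall x, exists y, p (y, x) by move=> x; have [] := ptot x.
exists g; split.
- exists g' => x; first by apply/(pf _ _ (gp' (g x)) (gp x)).
  by apply/(pf _ _ (gp (g' x)) (gp' x)).
- by move=> a /sub0 pa; apply/(pf _ _ (gp a.1) pa).
- by move=> x; exact/esym/(pc (fun k => (x k, g (x k)))).
Qed.

End Generic.

(** * Continuous formulas *)

Fixpoint tmap (F : Type) (ar : F -> nat) (V V' : Type) (k : V -> V')
    (t : term ar V) : term ar V' :=
  match t with
  | Var v => Var ar (k v)
  | App f args => App (fun i => tmap k (args i))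
  end.

Fixpoint cf_map (R : realType) (L : clang R) (V V' : Type) (k : V -> V')
    (phi : cformula L V) : cformula L V' :=
  match phi with
  | CDist s t => CDist (tmap k s) (tmap k t)
  | CPred P args => CPred (fun i => tmap k (args i))
  | CConn n u args => CConn u (fun i => cf_map k (args i))
  | CSup p => CSup (cf_map (omap k) p)
  | CInf p => CInf (cf_map (omap k) p)
  end.

Lemma teval_map (F : Type) (ar : F -> nat) (V V' M : Type)
    (I : forall f, ('I_(ar f) -> M) -> M) (k : V -> V') (t : term ar V) (a : V' -> M) :
  teval I a (tmap k t) = teval I (fun v => a (k v)) t.
Proof. by elim: t => //= f args IH; congr I; apply: funext => i; exact: IH. Qed.

Lemma ceval_map (R : realType) (L : clang R) (M : cstruct L) (V V' : Type)
    (k : V -> V') (phi : cformula L V) (a : V' -> M) :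
  ceval (cf_map k phi) a = ceval phi (fun v => a (k v)).
Proof.
have ext (W W' : Type) (h : W -> W') (b : W' -> M) x :
    (fun v => assign_ext b x (omap h v)) = assign_ext (fun v => b (h v)) x.
  by apply: funext => -[].
elim: phi V' k a => {V} /= [V s t|V P args|V n u args IH|V p IH|V p IH] V' k a.
- by rewrite !teval_map.
- by congr c_predI; apply: funext => i; rewrite teval_map.
- by congr (conn_fun u); apply/rowP => i; rewrite !mxE IH.
- by congr sup; apply: eq_imagel => x _; rewrite IH ext.
- by congr inf; apply: eq_imagel => x _; rewrite IH ext.
Qed.

Lemma image_setT_range01 (R : realType) (T : Type) (f : T -> R) (x : T) :
  (forall y, 0 <= f y <= 1) ->
  0 <= sup [set f y | y in [set: T]] <= 1 /\ 0 <= inf [set f y | y in [set: T]] <= 1.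
Proof.
move=> f01; set A := [set f y | y in [set: T]].
have Afx : A (f x) by exists x.
have ubA : ubound A 1 by move=> _ [y _ <-]; have /andP[] := f01 y.
have lbA : lbound A 0 by move=> _ [y _ <-]; have /andP[] := f01 y.
have A0 : A !=set0 by exists (f x).
have /andP[fx0 fx1] := f01 x.
split; apply/andP; split.
- by apply: le_trans fx0 _; apply: ub_le_sup => //; exists 1.
- exact: ge_sup.
- exact: lb_le_inf.
- by apply: le_trans fx1; apply: ge_inf => //; exists 0.
Qed.

Lemma ceval_range (R : realType) (L : clang R) (M : cstruct L) (V : Type)
    (phi : cformula L V) (a : V -> M) : 0 <= ceval phi a <= 1.
Proof.
have [x] := c_inhabited M.
elim: phi a => {V} /= [V s t|V P args|V n u args IH|V p IH|V p IH] a.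
- by rewrite mdist_ge0 c_diam.
- exact: c_predI_range.
- by apply: conn_range => i; rewrite mxE.
- by have [] := image_setT_range01 x (fun y => IH (assign_ext a y)).
- by have [] := image_setT_range01 x (fun y => IH (assign_ext a y)).
Qed.

(** Dependence is taken semantically, in [M], rather than by free variables; supports can then be
    intersected ([supportedI]). *)
Definition supported (R : realType) (L : clang R) (M : cstruct L) (V : Type)
    (D : set V) (phi : cformula L V) : Prop :=
  forall a b : V -> M, (forall v, D v -> a v = b v) -> ceval phi a = ceval phi b.

Lemma bigcup_ord_support (V M : Type) (n : nat) (P : 'I_n -> (V -> M) -> (V -> M) ->
  Prop) :
  (forall i, exists2 D : set V, finite_set D & forall a b : V -> M,
    (forall v, D v -> a v = b v) -> P i a b) ->
  exists2 D : set V, finite_set D & forall a b : V -> M,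
    (forall v, D v -> a v = b v) -> forall i, P i a b.
Proof.
move=> IH; have /choice[D DP] : forall i, exists D : set V, finite_set D /\
    forall a b : V -> M, (forall v, D v -> a v = b v) -> P i a b.
  by move=> i; have [D ? ?] := IH i; exists D.
exists (\bigcup_i D i).
  by apply: bigcup_finite => [|i _]; [exact: finite_finset|case: (DP i)].
move=> a b ab i.
by have [_ h] := DP i; apply: h => v Dv; apply: ab; exists i.
Qed.

Lemma teval_finite_support (F : Type) (ar : F -> nat) (V M : Type)
    (I : forall f, ('I_(ar f) -> M) -> M) (t : term ar V) :
  exists2 D : set V, finite_set D & forall a b : V -> M,
    (forall v, D v -> a v = b v) -> teval I a t = teval I b t.
Proof.
elim: t => [v|f args IH] /=.
  by exists [set v] => // a b; apply.
have [D finD DP] := bigcup_ord_support IH.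
by exists D => // a b /DP ab; congr I; apply: funext.
Qed.

Lemma ceval_finite_support (R : realType) (L : clang R) (M : cstruct L) (V : Type)
    (phi : cformula L V) : exists2 D : set V, finite_set D & supported M D phi.
Proof.
have ext (W : Type) (D : set (option W)) (a b : W -> M) x :
    (forall v, (Some @^-1` D) v -> a v = b v) ->
    forall v, D v -> assign_ext a x v = assign_ext b x v.
  by move=> ab [v|] //= Dv; exact: ab.
have fin (W : Type) (D : set (option W)) : finite_set D -> finite_set (Some @^-1` D).
  by move=> finD; apply: finite_preimage => // x y _ _ [].
rewrite /supported; elim: phi => {V} /= [V s t|V P args|V n u args IH|V p IH|V p IH].
- have [D finD Ds] := teval_finite_support (@c_funI R L M) s.
  have [E finE Et] := teval_finite_support (@c_funI R L M) t.
  exists (D `|` E); first by rewrite finite_setU.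
  by move=> a b ab; rewrite (Ds a b) 1?(Et a b) // => v ?; apply: ab; [right|left].
- have [D finD DP] := bigcup_ord_support (fun i =>
    teval_finite_support (@c_funI R L M) (args i)).
  by exists D => // a b /DP ab; congr c_predI; apply: funext.
- have [D finD DP] := bigcup_ord_support IH.
  by exists D => // a b /DP ab; congr (conn_fun u); apply/rowP => i; rewrite !mxE.
- have [D finD DP] := IH; exists (Some @^-1` D); first exact: fin.
  by move=> a b ab; congr sup; apply: eq_imagel => x _; exact/DP/ext.
- have [D finD DP] := IH; exists (Some @^-1` D); first exact: fin.
  by move=> a b ab; congr inf; apply: eq_imagel => x _; exact/DP/ext.
Qed.

Lemma ceval_automorphism (R : realType) (L : clang R) (M : cstruct L) (V : Type)
    (g : M -> M) (phi : cformula L V) (a : V -> M) :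
  automorphism g -> ceval phi (g \o a) = ceval phi a.
Proof.
move=> [[g' gK g'K] gd gf gP].
have gt (W : Type) (b : W -> M) t :
    teval (@c_funI R L M) (g \o b) t = g (teval (@c_funI R L M) b t).
  by elim: t => //= f args IH; rewrite gf; congr c_funI; apply: funext => i; exact: IH.
have ext (W : Type) (b : W -> M) x : assign_ext (g \o b) (g x) = g \o assign_ext b x.
  by apply: funext => -[].
have img (W : Type) (b : W -> M) p :
    (forall c, ceval p (g \o c) = ceval p c) ->
    [set ceval p (assign_ext (g \o b) x) | x in [set: M]] =
    [set ceval p (assign_ext b x) | x in [set: M]].
  move=> IH; apply/seteqP; split=> _ [x _ <-].
    by exists (g' x) => //; rewrite -IH -ext g'K.
  by exists (g x) => //; rewrite ext IH.
elim: phi a => {V} /= [V s t|V P args|V n u args IH|V p IH|V p IH] a.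
- by rewrite !gt gd.
- by rewrite -[RHS]gP; congr c_predI; apply: funext => i; exact: gt.
- by congr (conn_fun u); apply/rowP => i; rewrite !mxE IH.
- by rewrite img.
- by rewrite img.
Qed.

(** * Connectives for closed conditions *)

Lemma conn_max_range (R : realType) (x : 'rV[R]_2) : cube x ->
  0 <= Num.max (x ord0 ord0) (x ord0 ord_max) <= 1.
Proof.
move=> cx; have /andP[x0 x1] := cx ord0; have /andP[y0 y1] := cx ord_max.
by rewrite le_max ge_max x0 x1 y1.
Qed.

Lemma conn_max_cont (R : realType) : {within @cube R 2,
  continuous (fun x : 'rV[R]_2 => Num.max (x ord0 ord0) (x ord0 ord_max))}.
Proof.
apply: continuous_subspaceT => x.
by apply: continuous_max; exact: coord_continuous.
Qed.

Definition conn_max (R : realType) := Connective (@conn_max_range R) (@conn_max_cont R).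

Lemma coord_sub_continuous (R : realType) (e : R) (x : 'rV[R]_1) :
  {for x, continuous (fun x : 'rV[R]_1 => x ord0 ord0 - e : R^o)}.
Proof.
by apply: (@continuousB R R^o); [exact: coord_continuous|exact: cst_continuous].
Qed.

Lemma conn_dev_range (R : realType) (e : R) (e01 : 0 <= e <= 1) (x : 'rV[R]_1) :
  cube x -> 0 <= `|x ord0 ord0 - e| <= 1.
Proof.
move=> cx; have /andP[x0 x1] := cx ord0; have /andP[e0 e1] := e01.
by rewrite normr_ge0 /= ler_norml; apply/andP; split; lra.
Qed.

Lemma conn_dev_cont (R : realType) (e : R) : {within @cube R 1,
  continuous (fun x : 'rV[R]_1 => `|x ord0 ord0 - e|)}.
Proof.
apply: continuous_subspaceT => x.
exact: (continuous_comp (@coord_sub_continuous R e x) (@norm_continuous R R^o _)).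
Qed.

Definition conn_dev (R : realType) (e : R) (e01 : 0 <= e <= 1) :=
  Connective (conn_dev_range e01) (@conn_dev_cont R e).

Lemma conn_sub_range (R : realType) (e : R) (e0 : 0 <= e) (x : 'rV[R]_1) :
  cube x -> 0 <= Num.max 0 (x ord0 ord0 - e) <= 1.
Proof.
move=> cx; have /andP[x0 x1] := cx ord0.
by rewrite le_max lexx ge_max ler01 /=; lra.
Qed.

Lemma conn_sub_cont (R : realType) (e : R) : {within @cube R 1,
  continuous (fun x : 'rV[R]_1 => Num.max 0 (x ord0 ord0 - e))}.
Proof.
apply: continuous_subspaceT => x.
have c0 : {for x, continuous (fun=> 0 : R^o)} by exact: cst_continuous.
exact: (continuous_max c0 (@coord_sub_continuous R e x)).
Qed.

Definition conn_sub (R : realType) (e : R) (e0 : 0 <= e) :=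
  Connective (conn_sub_range e0) (@conn_sub_cont R e).

Section Connectives.
Variables (R : realType) (L : clang R) (M : cstruct L) (V : Type).
Implicit Types (phi psi : cformula L V) (a : V -> M).

(** Conditions have the form [phi = 0], so these three express a conjunction of conditions,
    [phi = e], and [phi <= e]. *)
Definition cf_max phi psi :=
  CConn (conn_max R) (fun k => if k == ord0 then phi else psi).
Definition cf_dev (e : R) (e01 : 0 <= e <= 1) phi := CConn (conn_dev e01) (fun=> phi).
Definition cf_sub (e : R) (e0 : 0 <= e) phi := CConn (conn_sub e0) (fun=> phi).

Lemma ceval_max phi psi a : ceval (cf_max phi psi) a = Num.max (ceval phi a) (ceval
  psi a).
Proof. by rewrite /= !mxE. Qed.

Lemma ceval_dev e (e01 : 0 <= e <= 1) phi a : ceval (cf_dev e01 phi) a = `|ceval phi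
  a - e|.
Proof. by rewrite /= !mxE. Qed.

Lemma ceval_sub e (e0 : 0 <= e) phi a : ceval (cf_sub e0 phi) a = Num.max 0 (ceval
  phi a - e).
Proof. by rewrite /= !mxE. Qed.

End Connectives.

(** * Monster models of discrete coloured hypergraphs *)

Lemma pick_in_irrel (T : Type) (x y : T) (A : set T) :
  (exists z, A z) -> pick_in x A = pick_in y A.
Proof. by rewrite /pick_in; case: pselect. Qed.

Lemma ultra_finite (X : Type) (U : set_system X) (T : finType) (f : X -> T) :
  UltraFilter U -> exists c, U [set x | f x = c].
Proof.
move=> UU; apply: contrapT => nc.
have : \forall x \near U, forall c, f x <> c.
  apply: filter_forall => c.
  by have [Uc|] := in_ultra_setVsetC [set x | f x = c] UU; first by case: nc; exists c.
by move=> /filter_ex[x /(_ (f x))].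
Qed.

Lemma filter_meet (X : Type) (U : set_system X) (A B : set X) :
  ProperFilter U -> U A -> U B -> exists x, A x /\ B x.
Proof.
move=> UU UA UB; have UAB : U (A `&` B) by exact: filterI.
by have [x] := filter_ex UAB; exists x.
Qed.

Lemma ultra_uniq (X T : Type) (U : set_system X) (f : X -> T) c c' :
  ProperFilter U -> U [set x | f x = c] -> U [set x | f x = c'] -> c = c'.
Proof.
move=> UU Uc Uc'; have [x [/= fc fc']] := filter_meet UU Uc Uc'.
by rewrite -fc -fc'.
Qed.

(* R is a phantom argument: it fixes the field in which distances are valued. *)
Definition disc (R : realType) (M : Type) : Type := {classic M}.
HB.instance Definition _ (R : realType) (M : Type) :=
  Choice.copy (disc R M) {classic M}.

Section Discrete.
Variables (R : realType) (M : Type).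
Implicit Types x y z : disc R M.

Let dd x y : R := (x != y)%:R.
Let ddxx x : dd x x = 0. Proof. by rewrite /dd eqxx. Qed.
Let dd_pos x y : dd x y = 0 -> x = y.
Proof. by rewrite /dd; case: eqVneq => //= _ /eqP; rewrite oner_eq0. Qed.
Let dd_sym x y : dd x y = dd y x. Proof. by rewrite /dd eq_sym. Qed.
Let dd_triangle y x z : dd x z <= dd x y + dd y z.
Proof.
rewrite /dd; case: (eqVneq x z) => [_|xz] /=; first by rewrite addr_ge0.
by case: (eqVneq x y) => [<-|_] /=; rewrite ?xz ?add0r // lerDl.
Qed.

HB.instance Definition _ := isMetric.Build R (disc R M) ddxx dd_pos dd_sym dd_triangle.

Lemma disc_mdistE x y : mdist x y = (x != y)%:R. Proof. by []. Qed.

Lemma disc_mdist_lt1 x y : mdist x y < 1 -> x = y.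
Proof. by rewrite disc_mdistE; case: eqVneq => //=; rewrite ltxx. Qed.

Lemma disc_mdist_eq x y x' y' : mdist x y = mdist x' y' -> x = y <-> x' = y'.
Proof.
rewrite !disc_mdistE; case: (eqVneq x y) => [->|/eqP ?];
  case: (eqVneq x' y') => [->|/eqP ?] /= /eqP //.
- by rewrite eq_sym oner_eq0.
- by rewrite oner_eq0.
Qed.

Lemma disc_complete (F : set_system (disc R M)) :
  ProperFilter F -> cauchy F -> exists x : disc R M, F --> x.
Proof.
move=> FF cF.
have /cauchy_ballP/(_ 1 ltr01) := cF.
case=> -[A B] [/= FA FB] AB.
have /filter_ex[x Ax] := FA; exists x => N Nx.
apply: filterS FB => y By.
have /= := AB (x, y) (conj Ax By); rewrite ballEmdist => /disc_mdist_lt1 <-.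
exact: nbhs_singleton.
Qed.

End Discrete.

Section Hypergraph.
Variables (R : realType) (n r : nat).

Lemma hlang_fmod_range (f : void) (e : R) : 0 < e <= 1 -> (0 : R) < (of_void R f) <= 1.
Proof. by case: f. Qed.

Lemma hlang_pmod_range (P : unit) (e : R) : 0 < e <= 1 -> (0 : R) < 1 <= (1 : R).
Proof. by rewrite ltr01 lexx. Qed.

(** The constant modulus 1 fits discrete structures, where points at distance less than 1 are
    equal. *)
Definition hlang : clang R :=
  @CLang R void (fun=> 0%N) (fun f _ => of_void R f) unit (fun=> n) (fun _ _ => 1)
    hlang_fmod_range hlang_pmod_range.

Variables (M : Type) (x0 : M) (col : ('I_n -> M) -> 'I_r.+1).

Definition hval (c : 'I_r.+1) : R := c%:R / r.+1%:R.

Lemma hval_range c : 0 <= hval c <= 1.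
Proof.
by rewrite /hval divr_ge0 // ler_pdivrMr ?ltr0n // mul1r ler_nat ltnW.
Qed.

Lemma hval_inj : injective hval.
Proof.
move=> c d /divIf e; apply/val_inj/eqP; rewrite -(eqr_nat R); apply/eqP/e.
by rewrite pnatr_eq0.
Qed.

Let hM : metricType R := disc R M.

Lemma hstr_diam (x y : hM) : mdist x y <= 1.
Proof. by rewrite disc_mdistE; case: (_ != _). Qed.

Lemma hstr_pred_uc (P : unit) (x y : 'I_n -> hM) (e : R) :
  0 < e <= 1 -> (forall i, mdist (x i) (y i) < 1) ->
    `|hval (col x) - hval (col y)| <= e.
Proof.
move=> /andP[e0 _] xy; rewrite (_ : x = y) ?subrr ?normr0 ?ltW //.
by apply: funext => i; exact: disc_mdist_lt1.
Qed.

Definition hstr : cstruct hlang :=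
  @CStruct R hlang hM (inhabits (x0 : hM)) hstr_diam (@disc_complete R M)
    (fun f => match f with end) (fun _ x => hval (col x))
    (fun _ x => hval_range (col x)) (fun f => match f with end) hstr_pred_uc.

Lemma hstr_automorphism (g : M -> M) : bijective g ->
  (forall x, col (g \o x) = col x) -> automorphism (g : hstr -> hstr).
Proof.
move=> bg gc; split=> //.
- move=> x y; rewrite /= !disc_mdistE.
  by rewrite (@inj_eq (disc R M) (disc R M) g (bij_inj bg)).
- by move=> [] x /=; rewrite gc.
Qed.

Definition hiso (p : set (M * M)) : Prop :=
  (forall a b, p a -> p b -> a.1 = b.1 <-> a.2 = b.2) /\
  (forall z : 'I_n -> M * M, (forall k, p (z k)) ->
     col (fun k => (z k).1) = col (fun k => (z k).2)).

Variable K : Type.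
Hypothesis K_infinite : infinite_set [set: K].
Hypothesis hhom : forall p, hiso p -> p #<= [set: K] ->
  exists g : M -> M, [/\ bijective g, forall a, p a -> g a.1 = a.2
    & forall x : 'I_n -> M, col (g \o x) = col x].
Hypothesis hext : forall (A : set M) (m : nat) (Q : ('I_n -> 'I_m + A) -> 'I_r.+1),
  A #<= [set: K] ->
  (forall y : 'I_n -> A, Q (fun k => inr (y k)) = col (fun k => val (y k))) ->
  exists e : 'I_m + A -> M, [/\ injective e, forall a, e (inr a) = val a
    & forall y, col (fun k => e (y k)) = Q y].

Lemma hstr_strongly_homogeneous : strongly_homogeneous K hstr.
Proof.
move=> A [AK _] f ftp.
have eqf (a b : A) : val a = val b <-> f a = f b.
  exact: (disc_mdist_eq (ftp (CDist (Var _ a) (Var _ b)))).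
have colf (y : 'I_n -> A) : col (fun k => val (y k)) = col (fun k => f (y k)).
  exact: (hval_inj (ftp (@CPred R hlang A tt (fun k => Var _ (y k))))).
have [||g [bg gp gc]] := hhom (p := range (fun a : A => (val a, f a))).
- split=> [_ _ [a _ <-] [b _ <-]|z zp]; first exact: eqf.
  have /choice[y yz] : forall k, exists a : A, (val a, f a) = z k.
    by move=> k; have [a _ <-] := zp k; exists a.
  rewrite (_ : z = fun k => (val (y k), f (y k))); last by apply: funext => k;
    rewrite yz.
  exact: colf.
- apply: card_le_trans (card_image_le _ _) _.
  by apply: card_le_trans AK;
    apply: (card_le_inj (f := val)) => [a _|a b _ _ /val_inj//];
    exact/set_mem/valP.
exists g; split; first exact: hstr_automorphism.
by move=> a; apply: (gp (val a, f a)); exists a.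
Qed.

Lemma finite_set_enum (T : Type) (S : set T) : finite_set S ->
  exists (k : nat) (s : 'I_k -> T), S = range s.
Proof.
move=> finS; have [[x Sx]|/set0P/negP/negPn/eqP ->] := pselect (S !=set0); last first.
  exists 0%N, (fun i : 'I_0 => match i with Ordinal m h =>
    False_rect T (Bool.diff_false_true h) end).
  by apply/seteqP; split=> // y [[]].
have [k /card_eqPle[Sk kS]] := finS.
have [|f [fS fi]] := inj_of_card_le Sk; first by exists x.
exists k, (fun i : 'I_k => pick_in x [set y | S y /\ f y = i]).
apply/seteqP; split=> [y Sy|_ [i _ <-]].
  have lt : (f y < k)%N by exact: fS.
  exists (Ordinal lt) => //=.
  have [Sz fz] := @pick_inP _ x [set z | S z /\ f z = f y] (ex_intro _ y (conj Sy
    erefl)).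
  exact: fi.
have [[y yP]|ny] := pselect (exists y, S y /\ f y = i).
  by have [] := @pick_inP _ x [set z | S z /\ f z = i] (ex_intro _ y yP).
by rewrite /pick_in; case: pselect.
Qed.

(** An ultrafilter on approximate solutions decides equalities [eqv] and colours [Q] for variables
    and parameters, and [hext] realizes them. A formula of [Gamma] depends on finitely many
    variables, on which some [x] solving it has the decided equalities and colours; [hhom] carries
    this part of [x] to the realization by an automorphism, which preserves the value 0. *)
Lemma hstr_saturated : saturated K hstr.
Proof.
move=> A [AK _] m Gamma Gfin.
pose X := 'I_m -> hstr; pose V := ('I_m + A)%type.
pose val_at (x : X) (v : V) : M := param_assign x v.
pose B (G0 : set (cformula hlang V)) : set X :=
  [set x | forall phi, G0 phi -> ceval phi (param_assign x) = 0].
pose F := filter_from [set G0 | finite_set G0 /\ G0 `<=` Gamma] B.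
have FF : ProperFilter F.
  apply: filter_from_proper; last by move=> G0 [fin0 sub0]; exact: Gfin.
  apply: filter_from_filter; first by exists set0; split=> //; exact: finite_set0.
  move=> G1 G2 [fin1 sub1] [fin2 sub2]; exists (G1 `|` G2).
    by split; [rewrite finite_setU|rewrite subUset].
  by move=> x Bx; split=> phi Gphi; apply: Bx; [left|right].
have [U [UU FU]] := ultraFilterLemma FF.
have UG phi : Gamma phi -> U [set x | ceval phi (param_assign x) = 0].
  move=> Gphi; apply: FU; exists [set phi]; first by split=> // _ ->.
  by move=> x; apply.
pose eqv v w := U [set x | val_at x v = val_at x w].
have eqvv v : eqv v v by apply: filterS (@filterT _ U _) => x.
have eqv_sym v w : eqv v w -> eqv w v by apply: filterS => x /= ->.
have eqv_trans v w u : eqv v w -> eqv w u -> eqv v u.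
  by move=> vw wu; apply: filterS (filterI vw wu) => x [/= -> ->].
have eqvA a b : eqv (inr a) (inr b) -> a = b.
  by move=> /filter_ex[x /= /val_inj].
have /choice[Q QP] : forall y : 'I_n ->
  V, exists c, U [set x | col (fun k => val_at x (y k)) = c].
  by move=> y; exact: ultra_finite.
have QE y c : U [set x | col (fun k => val_at x (y k)) = c] -> Q y = c.
  by move=> Uc; exact: (ultra_uniq _ (QP y) Uc).
have Qeqv y y' : (forall k, eqv (y k) (y' k)) -> Q y = Q y'.
  move=> yy'; apply: QE; have : U [set x | forall k, val_at x (y k) = val_at x (y' k)].
    exact: filter_forall.
  move=> Uyy'; apply: filterS (filterI Uyy' (QP y')) => x [/= exy <-].
  by congr col; apply: funext.
have [|e [ei eA ec]] := hext (Q := Q) AK.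
  by move=> y; apply: QE; apply: filterS (@filterT _ U _) => x.
pose D (v : V) := if v is inr _ then True else False.
(* [hext] yields distinct points, so equal variables must share a representative. A class that meets
   the parameters keeps only parameters as candidates, so that each parameter represents itself. *)
pose cls v := [set w | eqv v w /\ ((exists w', D w' /\ eqv v w') -> D w)].
have cls_ex v : exists w, cls v w.
  have [[w [Dw vw]]|nD] := pselect (exists w', D w' /\ eqv v w'); first by exists w.
  by exists v; split.
pose rep v := pick_in v (cls v).
have repP v : cls v (rep v) by exact: pick_inP.
have repA a : rep (inr a) = inr a.
  have [ea Da] := repP (inr a).
  have {}Da : D (rep (inr a)) by apply: Da; exists (inr a).
  by move: ea Da; case: (rep (inr a)) => // b /eqvA ->.
have rep_eq v w : rep v = rep w <-> eqv v w.
  split=> [e'|vw].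
    have [v1 _] := repP v; have [w1 _] := repP w.
    by apply: eqv_trans v1 _; rewrite e'; exact: eqv_sym.
  suff cE : cls v = cls w by rewrite /rep cE; apply: pick_in_irrel; rewrite -cE.
  apply/seteqP; split=> u [uv uD]; split.
  - exact: eqv_trans (eqv_sym _ _ vw) uv.
  - by move=> [w' [Dw' ww']]; apply: uD; exists w'; split=> //; exact: eqv_trans vw ww'.
  - exact: eqv_trans vw uv.
  - move=> [w' [Dw' ww']]; apply: uD; exists w'; split=> //.
    exact: eqv_trans (eqv_sym _ _ vw) ww'.
pose xs v : M := e (rep v).
exists (fun i => xs (inl i)) => phi Gphi.
have xsE : param_assign (fun i => xs (inl i) : hstr) = xs :> (V -> M).
  by apply: funext => -[i|a] //=; rewrite /xs repA eA.
have xs_eq v w : xs v = xs w <-> eqv v w.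
  by rewrite -rep_eq; split=> [/ei//|]; rewrite /xs => ->.
have xs_col y : col (fun k => xs (y k)) = Q y.
  by rewrite (ec (fun k => rep (y k))); apply: Qeqv => k; apply: eqv_sym;
    case: (repP (y k)).
have [S finS suppS] := ceval_finite_support hstr phi.
have [k [s Ss]] := finite_set_enum finS.
have U1 : U [set x | forall ij : 'I_k * 'I_k,
    val_at x (s ij.1) = val_at x (s ij.2) <-> eqv (s ij.1) (s ij.2)].
  apply: filter_forall => -[i j] /=.
  have [Uij|nU] := in_ultra_setVsetC [set x | val_at x (s i) = val_at x (s j)] UU.
    by apply: filterS (Uij) => x xij; split.
  apply: filterS (nU) => x nx; split=> [//|Uij].
  by have [z []] := filter_meet _ Uij nU.
(* Finite functions form a finite type, so the conditions can be intersected within the filter. *)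
have U2 : U [set x | forall t : {ffun 'I_n -> 'I_k},
    col (fun l => val_at x (s (t l))) = Q (fun l => s (t l))].
  by apply: filter_forall => t; exact: QP.
have [x [[x1 x2] x3]] := filter_meet _ (filterI U1 U2) (UG _ Gphi).
have [||g [bg gp gc]] := hhom (p := range (fun i : 'I_k => (val_at x (s i), xs (s i)))).
- split=> [_ _ [i _ <-] [j _ <-] /=|z zp].
    by rewrite xs_eq; exact: (x1 (i, j)).
  have /choice[t tz] : forall l, exists i, (val_at x (s i), xs (s i)) = z l.
    by move=> l; have [i _ <-] := zp l; exists i.
  rewrite (_ : z = fun l => (val_at x (s (t l)), xs (s (t l))));
    last by apply: funext => l; rewrite tz.
  rewrite /= xs_col; have := x2 (finfun t).
  by rewrite (_ : (fun l => s (finfun t l)) = fun l => s (t l));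
    [move=> <-; congr col; apply: funext => l|apply: funext => l]; rewrite ffunE.
- apply: (@card_le_trans _ nat _ [set: nat]); last exact/infiniteP.
  apply: finite_set_countable; apply: finite_image; exact: finite_finset.
rewrite xsE (suppS _ ((g : hstr -> hstr) \o param_assign x)).
  by rewrite ceval_automorphism //; exact: hstr_automorphism.
by move=> v; rewrite Ss => -[i _ <-] /=; apply/esym/(gp (val_at x (s i), xs (s i)));
  exists i.
Qed.

End Hypergraph.

Lemma card_lt_finite (T K : Type) : finite_set [set: T] -> infinite_set [set: K] ->
  card_lt [set: T] [set: K].
Proof.
move=> finT infK; split; last by move=> KT; apply: infK; exact: card_le_finite KT finT.
by apply: card_le_trans (finite_set_countable finT) _; exact/infiniteP.
Qed.

Lemma generic_monster (R : realType) (I : Type) (n r : nat)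
    (chi : ('I_n -> I) -> 'I_r.+1) : infinite_set [set: I] ->
  exists (K M : Type) (x0 : M) (col : ('I_n -> M) -> 'I_r.+1) (a : I -> M),
  [/\ monster_model (Th (hstr R x0 col)) K (hstr R x0 col), card_lt [set: I] [set: K]
    & forall x, col (fun k => a (x k)) = chi x].
Proof.
move=> infI; pose K := set I; have IK := card_lt_powerset I.
have infK : infinite_set [set: K].
  by apply: contra_not infI; apply: card_le_finite; case: IK.
have [Lam [lt [wo [l0] bnd]]] := regular_successor infK.
have [k0 _] := infinite_setN0 infK.
(* The labels for new points: elements of [I] for the copy of [I] itself, numbers for the unknowns
   of a type in saturation. *)
have [M [lev [new [lev_new new_inj]]]] := tower_exists wo (I + nat) 'I_r.+1 n.
have nomax xi : exists xi', lt xi xi'.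
  by have [xi' h] := bnd (fun=> xi); exists xi'; exact: h k0.
have boundA (T : Type) (A : set T) (l : T -> Lam) : A #<= [set: K] ->
    exists xi, forall a, A a -> lt (l a) xi.
  move=> AK; have [[a0 Aa0]|A0] := pselect (A !=set0); last first.
    by exists l0 => a Aa; case: A0; exists a.
  have [|f [_ fi]] := inj_of_card_le AK; first by exists a0.
  have [xi xiP] := bnd (fun k => l (pick_in a0 [set a | A a /\ f a = k])).
  exists xi => a Aa; have := xiP (f a); set b := pick_in _ _.
  have [Ab fb] : A b /\ f b = f a
    by apply: (@pick_inP _ a0 [set b | A b /\ f b = f a]); exists a.
  by rewrite (fi b a).
(* The tuple of length 0 gets the default colour, whence this choice. *)
pose c0 : 'I_r.+1 := pick_in ord0 [set c | exists y : 'I_n ->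
  I, (forall k : 'I_n, False) /\ chi y = c].
pose col := colour lt c0 lev new.
pose x0 := new l0 (fun=> ord0) (fun=> None) (inr (inr 0%N)).
have [|||s t []||a [_ _ ac _]] := @extension _ _ wo _ _ c0 _ _ lev new lev_new new_inj
    I chi set0 (fun=> x0) l0 (fun i => inr (inl i)).
- by move=> s t [].
- by [].
- by [].
- move=> y y0; rewrite /colour {1}/pick_in; case: pselect => [e|_].
    by exfalso; case: e => c [? [? [? [? [_ _ [k]]]]]]; case: (y0 k).
  have [|z [_ zc]] := @pick_inP _ ord0
      [set c | exists z : 'I_n -> I, (forall k : 'I_n, False) /\ chi z = c].
    by exists (chi y), y; split=> // k; exact: (y0 k).
  by rewrite /= -[LHS]/c0 -[LHS]zc; congr chi; apply: funext => k; case: (y0 k).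
have hhom p : hiso col p -> p #<= [set: K] ->
    exists g : M -> M, [/\ bijective g, forall a, p a -> g a.1 = a.2
      & forall x : 'I_n -> M, col (g \o x) = col x].
  move=> isop pK; have [xi1 b1] := boundA _ p (fun a => lev a.1) pK.
  have [xi2 b2] := boundA _ p (fun a => lev a.2) pK.
  have [xi b] : exists xi, bounded_by lt lev p xi.
    case: (swo_tri wo xi1 xi2) => [l|e|l].
    - by exists xi2 => a' pa; split; [exact: (swo_trans wo (b1 _ pa) l)|exact: b2].
    - by exists xi2 => a' pa; split; [rewrite -e; exact: b1|exact: b2].
    - by exists xi1 => a' pa; split; [exact: b1|exact: (swo_trans wo (b2 _ pa) l)].
  exact: (homogeneity wo lev_new new_inj nomax isop b).
exists K, M, x0, col, a; split=> //.
have NI : [set: nat] #<= [set: I] by exact/infiniteP.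
split=> //.
- split; [|exact: (card_lt_finite (@finite_finset void setT) infK)|
    exact: (card_lt_finite (@finite_finset unit setT) infK)].
  split; first by apply: card_le_trans NI IK.1.
  by move=> KN; apply: IK.2; exact: card_le_trans KN NI.
- apply: hstr_saturated => //.
  move=> A m Q AK QA; have [xi b] := boundA _ A lev AK.
  have [||||y yD|e [eA ei ec _]] := @extension _ _ wo _ _ c0 _ _ lev new lev_new new_inj
      ('I_m + A)%type Q [set v | if v is inr _ then True else False]
      (fun v => if v is inr a' then val a' else x0) xi
      (fun v => match v with inl i => inr (inr (nat_of_ord i)) | inr a' =>
        inl (val a') end).
  + by move=> [i|a'] [j|b'] // [] => [/val_inj|/val_inj] ->.
  + by move=> [i|a'] //; apply: b; exact/set_mem/valP.
  + by move=> [i|a'] // _; apply: b; exact/set_mem/valP.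
  + by move=> [i|a'] [j|b'] // _ _ /val_inj ->.
  + have /choice[z zy] : forall k, exists a', y k = inr a'.
        by move=> k; have := yD k; case: (y k) => // a' _; exists a'.
      rewrite (_ : y = fun k => inr (z k)); last by apply: funext => k; rewrite zy.
      by rewrite QA.
  exists e; split=> //.
  by move=> a'; rewrite eA.
- exact: hstr_strongly_homogeneous.
Qed.

(** * Quantifier-free types and embeddings *)

Section FirstOrder.
Variable L : folang.
Implicit Types M N P : fostruct L.

Definition qf_equiv M N (n : nat) (i : 'I_n -> M) (j : 'I_n -> N) : Prop :=
  forall psi : qfformula L 'I_n, qfsat i psi <-> qfsat j psi.

Lemma qf_equiv_sym M N n (i : 'I_n -> M) (j : 'I_n -> N) : qf_equiv i j -> qf_equiv j i.
Proof. by move=> ij psi; split=> /ij. Qed.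

Lemma qf_equiv_trans M N P n (i : 'I_n -> M) (j : 'I_n -> N) (k : 'I_n -> P) :
  qf_equiv i j -> qf_equiv j k -> qf_equiv i k.
Proof. by move=> ij jk psi; rewrite ij. Qed.

Lemma teval_embedding M N (g : embedding M N) (V : Type) (a : V -> M) t :
  teval (@fo_funI L N) (fun v => g (a v)) t = g (teval (@fo_funI L M) a t).
Proof.
have [_ gf _] := embP g.
by elim: t => //= f args IH; rewrite gf; congr fo_funI; apply: funext => k; exact: IH.
Qed.

Lemma qf_embedding M N (g : embedding M N) n (i : 'I_n -> M) :
  qf_equiv i (fun k => g (i k)).
Proof.
have [gi _ gr] := embP g.
elim=> //= [s t|r args|p IH|p IHp q IHq].
- by rewrite !teval_embedding; split=> [->|/gi].
- rewrite gr (_ : _ \o _ = fun k => teval (@fo_funI L N) (fun k =>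
    g (i k)) (args k)) //.
  by apply: funext => k; rewrite teval_embedding.
- by rewrite IH.
- by rewrite IHp IHq.
Qed.

(** The value of a term at [i] is sent to its value at [j]. Equality atoms make this well defined
    and injective, and the other atoms preserve the relations. *)
Lemma embedding_of_qf M N n (i : 'I_n -> M) (j : 'I_n -> N) :
  qf_equiv i j -> (forall x, exists t, teval (@fo_funI L M) i t = x) ->
  exists e : embedding M N, forall k, e (i k) = j k.
Proof.
move=> ij /choice[t tP]; pose e x := teval (@fo_funI L N) j (t x).
have eE s : e (teval (@fo_funI L M) i s) = teval (@fo_funI L N) j s.
  by apply/(ij (QEq (t _) s)); rewrite /= tP.
have emb : is_embedding e.
  split.
  - by move=> x y /(ij (QEq (t x) (t y))) /=; rewrite !tP.
  - move=> f x; rewrite -[RHS](eE (App (fun k => t (x k)))) /=; congr e.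
    by congr fo_funI; apply: funext => k; rewrite tP.
  - move=> r x; have /= := ij (QRel (fun k => t (x k))).
    by rewrite (_ : (fun k => teval _ i (t (x k))) = x) //; apply: funext.
by exists (Embedding emb) => k /=; exact: (eE (Var _ k)).
Qed.

Lemma embedding_eq M N (g h : embedding M N) : (forall x, g x = h x) -> g = h.
Proof.
case: g h => [g gP] [h hP] /= /funext gh; case: h / gh in hP *.
by congr Embedding; exact: Prop_irrelevance.
Qed.

Lemma is_embedding_val M (A : substruct M) : is_embedding (val : sub_str A -> M).
Proof. by split=> //; exact: val_inj. Qed.

Definition sub_incl M (A : substruct M) : embedding (sub_str A) M :=
  Embedding (is_embedding_val A).

Lemma embedding_corestrict M N (g : embedding M N) (A : substruct N) :
  (forall x, sub_set A (g x)) ->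
    exists h : embedding M (sub_str A), forall x, val (h x) = g x.
Proof.
move=> gA; have [gi gf gr] := embP g.
have hP : is_embedding (fun x => SigSub (mem_set (gA x)) : sub_str A).
  split=> [x y [] /gi//|f x|r x]; last exact: gr.
  by apply: val_inj => /=; rewrite gf.
by exists (Embedding hP).
Qed.

Lemma image_closed M N (g : embedding M N) (f : fo_fun L) (x : 'I_(fo_far f) -> N) :
  (forall i, range g (x i)) -> range g (fo_funI x).
Proof.
move=> /(_ _)/cid2-/all_sig2[y _ yx]; have [_ gf _] := embP g.
by exists (fo_funI y) => //; rewrite gf; congr fo_funI; apply: funext.
Qed.

Definition image_str M N (g : embedding M N) : substruct N :=
  Substruct (@image_closed M N g).

Lemma generated_closed M (X : set M) (f : fo_fun L) (x : 'I_(fo_far f) -> M) :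
  (forall i (A : substruct M), X `<=` A -> sub_set A (x i)) ->
  forall A : substruct M, X `<=` A -> sub_set A (fo_funI x).
Proof. by move=> xA A XA; apply: sub_closed => i; exact: xA. Qed.

Definition generated M (X : set M) : substruct M :=
  @Substruct L M [set x | forall A : substruct M, X `<=` A ->
    sub_set A x] (@generated_closed M X).

Lemma generatesP M (X : set M) : generates X (generated X).
Proof. by split=> [x Xx A|A XA x]; apply. Qed.

Lemma terms_closed M (V : Type) (i : V -> M) (f : fo_fun L) (x : 'I_(fo_far f) -> M) :
  (forall k, range (teval (@fo_funI L M) i) (x k)) ->
  range (teval (@fo_funI L M) i) (fo_funI x).
Proof.
move=> /(_ _)/cid2-/all_sig2[t _ tx].
by exists (App t) => //=; congr fo_funI; apply: funext.
Qed.

Lemma generated_term M n (i : 'I_n -> M) x : sub_set (generated (range i)) x ->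
  exists t, teval (@fo_funI L M) i t = x.
Proof.
move=> /(_ (Substruct (@terms_closed M 'I_n i)))[]; last by move=> t _ <-; exists t.
by move=> _ [k _ <-]; exists (Var _ k).
Qed.

(** A finite image is a finite generating set of itself; conversely local finiteness makes members
    of the age finite. *)
Lemma age_iff M S : locally_finite M ->
  age M S <-> finite_set [set: S] /\ exists g : S -> M, is_embedding g.
Proof.
move=> locfin; split=> [[A [fgA [g [gP gbij]]]]|[finS [g gP]]].
  split; last by exists (emb_comp (sub_incl A) (Embedding gP));
    exact: is_embedding_comp.
  apply: card_le_finite (locfin A fgA); apply: (card_le_inj (f := fun x => val (g x))).
    by move=> x _; exact/set_mem/valP.
  by move=> x y _ _ /val_inj/(bij_inj gbij).
pose e := Embedding gP; exists (image_str e); split.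
  exists (range g); split; first exact: finite_image.
  by split.
have [h hE] := @embedding_corestrict _ _ e (image_str e) (fun x =>
  ex_intro2 _ _ x Logic.I erefl).
exists h; split; first exact: embP.
have /choice[h' h'P] : forall y : sub_str (image_str e), exists x, h x = y.
  move=> y; have [x _ xy] : range e (val y) by exact/set_mem/valP.
  by exists x; apply: val_inj; rewrite hE.
exists h' => [x|y] //; have [hi _ _] := embP h; exact: hi.
Qed.

End FirstOrder.

(** * The modeling property implies the Ramsey property *)

(** Values of distinct colours differ by at least [1 / r.+1]; the tolerance is half of this gap. *)
Lemma hval_close (R : realType) (r : nat) (c d : 'I_r.+1) :
  `|hval R c - hval R d| <= (2 * r.+1)%:R^-1 -> c = d.
Proof.
move=> cd; apply/val_inj/eqP; apply: contraT => ncd.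
have r0 : (0 : R) < r.+1%:R by rewrite ltr0n.
have : 1 <= `|(c : nat)%:R - (d : nat)%:R : R|.
  have key (m k : nat) : (m < k)%N -> 1 <= `|m%:R - k%:R : R|.
    move=> mk; rewrite distrC -natrB ?(ltnW mk) // ger0_norm ?ler0n // ler1n.
    by rewrite subn_gt0.
  by case: (ltngtP c d) ncd => // h _; [|rewrite distrC]; exact: key.
move=> h1; have : `|c%:R - d%:R : R| / r.+1%:R <= (2 * r.+1)%:R^-1.
  by rewrite -[X in _ / X](gtr0_norm r0) -normf_div mulrBl.
rewrite ler_pdivrMr // natrM invfM mulfVK ?gt_eqF // => h2.
by have := le_trans h1 h2; lra.
Qed.

Lemma finitely_generated_finite (L : folang) (I : fostruct L) (C : substruct I) :
  finite_set (sub_set C) -> finitely_generated C.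
Proof. by move=> finC; exists C; split=> //; split. Qed.

Section ModelingRamsey.
Variables (R : realType) (L' : folang) (I : fostruct L').
Hypothesis I_infinite : infinite_set [set: I].
Hypothesis I_locfin : locally_finite I.

(* Compactness: colourings without homogeneous copies on all finite
   substructures C yield, along an ultrafilter, one on I. *)
Lemma bad_colouring (A B : fostruct L') (n r : nat) (iA : 'I_n -> A) :
  finite_set [set: B] -> (forall x, exists k, iA k = x) ->
  (forall C, age I C -> ~ ramsey_arrow C B A r.+1) ->
  exists chi : ('I_n -> I) -> 'I_r.+1, forall f : embedding B I,
    ~ (forall g g' : embedding A B,
         chi (fun k => f (g (iA k))) = chi (fun k => f (g' (iA k)))).
Proof.
move=> finB iAs bad.
pose FC := {C : substruct I | finite_set (sub_set C)}.
pose mkFC (C : substruct I) (finC : finite_set (sub_set C)) : FC :=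
  exist (fun C : substruct I => finite_set (sub_set C)) C finC.
have ageC (C : FC) : age I (sub_str (sval C)).
  exists (sval C); split; first exact/finitely_generated_finite/(svalP C).
  exists id; split; last by exists id.
  by split.
have chi_ex (C : FC) : exists chi : embedding A (sub_str (sval C)) -> 'I_r.+1,
    forall f : embedding B (sub_str (sval C)),
    ~ forall g g' : embedding A B, chi (emb_comp f g) = chi (emb_comp f g').
  have /existsNP[chi chiP] := bad _ (ageC C).
  by exists chi => f fP; apply: chiP; exists f.
pose chiC C := projT1 (cid (chi_ex C)).
have chiCP C := projT2 (cid (chi_ex C)).
pose up (C : FC) : set FC := [set C' | sub_set (sval C) `<=` sub_set (sval C')].
have FF : ProperFilter (filter_from [set: FC] up).
  apply: filter_from_proper; last by move=> C _; exists C => x.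
  apply: filter_fromT_filter.
    have fin0 : finite_set (sub_set (generated (set0 : set I))).
      by apply: I_locfin; exists set0; split; [exact: finite_set0|exact: generatesP].
    by exists (mkFC _ fin0).
  move=> C1 C2; pose X := sub_set (sval C1) `|` sub_set (sval C2).
  have finX : finite_set (sub_set (generated X)).
    apply: I_locfin; exists X; split; last exact: generatesP.
    by rewrite finite_setU; split; [exact: (svalP C1)|exact: (svalP C2)].
  exists (mkFC _ finX) => C XC; split=> x Cx; apply: XC => /= A' XA'; apply: XA';
    by [left|right].
have [U [UU FU]] := ultraFilterLemma FF.
(* Colourings of embeddings become colourings of tuples. As [iA] is onto, a tuple comes from at most
   one embedding of [A]; tuples that come from none get [ord0]. *)
pose cC (C : FC) (x : 'I_n -> I) : 'I_r.+1 := pick_in ord0 [set c | exists g :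
  embedding A (sub_str (sval C)), (forall k, val (g (iA k)) = x k) /\ chiC C g = c].
have cCE C (g : embedding A (sub_str (sval C))) : cC C (fun k =>
  val (g (iA k))) = chiC C g.
  rewrite /cC; set S := [set c | _].
  have [|h [hg <-]] := @pick_inP _ ord0 S; first by exists (chiC C g), g.
  congr (chiC C); apply: embedding_eq => x; have [k <-] := iAs x.
  exact/val_inj/hg.
have /choice[chi chiP] : forall x, exists c, U [set C | cC C x = c].
  by move=> x; exact: ultra_finite.
exists chi => f hom.
have [m [iB BE]] := finite_set_enum finB.
have iBs x : exists k, iB k = x.
  by have [k _ <-] : range iB x; [rewrite -BE|exists k].
have finf : finite_set (sub_set (image_str f)) by exact: finite_image.
have U1 : U [set C : FC | sub_set (image_str f) `<=` sub_set (sval C)].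
  by apply: FU; exists (mkFC _ finf).
have U2 : U [set C | forall t : {ffun 'I_n -> 'I_m},
    cC C (fun k => f (iB (t k))) = chi (fun k => f (iB (t k)))].
  by apply: filter_forall => t; exact: chiP.
have [C [C1 C2]] := filter_meet _ U1 U2.
have [f' f'E] := @embedding_corestrict _ _ _ f (sval C) (fun x =>
  C1 _ (ex_intro2 _ _ x Logic.I erefl)).
apply: (chiCP C f') => g g'.
have chiE h : chiC C (emb_comp f' h) = chi (fun k => f (h (iA k))).
  rewrite -cCE (_ : (fun k => _) = fun k => f (h (iA k)));
    last by apply: funext => k /=; rewrite f'E.
  have /choice[t tP] : forall k, exists l, iB l = h (iA k) by move=> k; exact: iBs.
  rewrite (_ : (fun k => _) = fun k => f (iB (finfun t k))); first exact: C2.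
  by apply: funext => k; rewrite ffunE tP.
by have := hom g g'; rewrite -!chiE.
Qed.

(** On the copy [f] of [B] supplied by local basedness, [chi] at [f o g] equals the colour of [b]
    along [beta o g]. All copies of [A] have the same quantifier-free type, so indiscernibility
    makes this colour independent of [g]. *)
Lemma ramsey_of_modeling :
  (forall (L : clang R) (T : ctheory L), complete_theory T ->
     continuous_modeling_property I T) ->
  embedding_ramsey_property (age I).
Proof.
move=> modeling B ageB A ageA r; apply: contrapT => nC.
have bad C : age I C -> ~ ramsey_arrow C B (sub_str A) r by move=> ageC arr;
  apply: nC; exists C.
have [finB [beta betaP]] := (age_iff B I_locfin).1 ageB.
have [finA _] := (age_iff (sub_str A) I_locfin).1 ageA.
(* With no colours [B] itself is a witness: [A] embeds in it, so there is no colouring to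
   consider. *)
case: r bad {nC} => [bad|r bad].
  by apply: (bad B ageB) => chi; case: (chi (sub_incl A)).
have [n [iA AE]] := finite_set_enum finA.
have iAs x : exists k, iA k = x.
  by have [k _ <-] : range iA x; [rewrite -AE|exists k].
have [m [iB BE]] := finite_set_enum finB.
have iBs x : exists k, iB k = x.
  by have [k _ <-] : range iB x; [rewrite -BE|exists k].
have [chi chiP] := bad_colouring finB iAs bad.
have [K [M [x0 [col [a [monster IK aE]]]]]] := generic_monster R chi I_infinite.
have infK : infinite_set [set: K].
  apply: contra_not I_infinite => finK; apply: card_le_finite finK; exact: IK.1.
have [|b [bind bbased]] := modeling _ _ _ K _ monster IK unit
    (card_lt_finite (@finite_finset unit setT) infK) (fun i _ => a i).
  by exists (hstr R x0 col).
(* Finitely many atomic formulas read the colours of all [n]-tuples from the enumeration of [B]. *)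
pose phi (t : {ffun 'I_n -> 'I_m}) : cformula (hlang R n) ('I_m * unit) :=
  @CPred R (hlang R n) _ tt (fun k => Var _ (t k, tt)).
pose j k := beta (iB k).
have [||i [ij iD]] := bbased m (range phi) j (2 * r.+1)%:R^-1.
- by apply: finite_image; exact: finite_finset.
- by rewrite invr_gt0 ltr0n.
have [f fE] : exists f : embedding B I, forall k, f (iB k) = i k.
  apply: embedding_of_qf; last by move=> x; have [k <-] := iBs x; exists (Var _ k).
  apply: qf_equiv_trans (qf_equiv_sym (M := I) ij).
  exact: (qf_embedding (Embedding betaP)).
apply: (chiP f) => g g'.
have colE (h : embedding (sub_str A) B) : chi (fun k => f (h (iA k))) =
    col (fun k => b (beta (h (iA k))) tt).
  have /choice[t tP] : forall k, exists l, iB l = h (iA k) by move=> k; exact: iBs.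
  have := iD (phi (finfun t)) (ex_intro2 _ _ (finfun t) Logic.I erefl).
  move=> /hval_close; rewrite /subtuple /=.
  rewrite (_ : (fun k => b (j (finfun t k)) tt) = fun k => b (beta (h (iA k))) tt);
    last first.
    by apply: funext => k; rewrite /j ffunE tP.
  rewrite (_ : (fun k => a (i (finfun t k))) = fun k => a (f (h (iA k)))); last first.
    by apply: funext => k; rewrite ffunE -tP fE.
  by move=> ->; rewrite (aE (fun k => f (h (iA k)))).
have qfE (h : embedding (sub_str A) B) : qf_equiv iA (fun k => beta (h (iA k))).
  exact: (qf_embedding (emb_comp (Embedding betaP) h)).
rewrite !colE.
have := bind n _ _ (qf_equiv_trans (qf_equiv_sym (qfE g)) (qfE g'))
  (@CPred R (hlang R n) _ tt (fun k => Var _ (k, tt))).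
exact: hval_inj.
Qed.

End ModelingRamsey.

(** * The Ramsey property implies the modeling property *)

Section RamseyUltrafilter.
Variables (L' : folang) (I : fostruct L').
Hypothesis I_locfin : locally_finite I.
Hypothesis erp : embedding_ramsey_property (age I).

Record task := Task {
  t_size : nat;
  t_left : 'I_t_size -> I;
  t_right : 'I_t_size -> I;
  t_same : same_qftp t_left t_right;
  t_num : nat;
  t_col : ('I_t_size -> I) -> 'I_t_num.+1 }.

Arguments t_left t : clear implicits.
Arguments t_right t : clear implicits.
Arguments t_col t : clear implicits.

(** All copies in [B] of the tuple are compared, not just one pair, so the property survives
    precomposition with an embedding. *)
Definition homogeneous (B : fostruct L') (g : B -> I) (t : task) : Prop :=
  forall j j' : 'I_(t_size t) -> B, qf_equiv j (t_left t) -> qf_equiv j' (t_left t) ->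
  t_col t (fun k => g (j k)) = t_col t (fun k => g (j' k)).

(** The remaining tasks are first solved on a larger [C] that is Ramsey for [B] and the substructure
    [A] generated by a copy of the tuple. Restricting to a homogeneous copy of [B] in [C] settles
    the present task and retains the others. Without a copy of the tuple the task is vacuous. *)
Lemma ramsey_tasks (l : seq task) (B : fostruct L') : age I B ->
  exists g : embedding B I, foldr (fun t P => homogeneous g t /\ P) True l.
Proof.
elim: l B => [|t l IH] B ageB.
  by have [_ [g gP]] := (age_iff B I_locfin).1 ageB; exists (Embedding gP).
have [[j0 j0t]|nj] := pselect (exists j0 : 'I_(t_size t) ->
  B, qf_equiv j0 (t_left t)); last first.
  have [g gl] := IH B ageB; exists g; split=> // j j' jt.
  by case: nj; exists j.
have [finB [beta betaP]] := (age_iff B I_locfin).1 ageB.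
pose A := generated (range j0).
have j0A k : sub_set A (j0 k) by apply: (generatesP (range j0)).1; exists k.
have ageA : age I (sub_str A).
  apply/age_iff => //; split.
    by apply: card_le_finite finB;
      apply: (card_le_inj (f := val)) => // x y _ _ /val_inj.
  by exists (emb_comp (Embedding betaP) (sub_incl A)); exact: is_embedding_comp.
have [C [ageC arr]] := erp ageB ageA (t_num t).+1.
have [h hl] := IH C ageC.
pose jA k : sub_str A := SigSub (mem_set (j0A k)).
have [f fP] := arr (fun e => t_col t (fun k => h (e (jA k)))).
exists (emb_comp h f); split.
  move=> j j' jt j't.
  have ext (i : 'I_(t_size t) -> B) : qf_equiv i (t_left t) ->
      exists e : embedding (sub_str A) B, forall k, e (jA k) = i k.
    move=> it; apply: embedding_of_qf.
      apply: qf_equiv_trans (qf_embedding (sub_incl A) jA) _.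
      exact: qf_equiv_trans j0t (qf_equiv_sym it).
    move=> x; have [s sx] := generated_term (set_mem (valP x)).
    by exists s; apply: val_inj; rewrite -sx -[LHS](teval_embedding (sub_incl A)).
  have [e eP] := ext j jt; have [e' e'P] := ext j' j't.
  have := fP e e'; rewrite /=.
  rewrite (_ : (fun k => h (f (e (jA k)))) = fun k => h (f (j k)));
    last by apply: funext => k; rewrite eP.
  by rewrite (_ : (fun k => h (f (e' (jA k)))) = fun k => h (f (j' k)));
    last by apply: funext => k; rewrite e'P.
elim: l hl {IH} => //= s l IHl [hs hl]; split; last exact: IHl.
move=> j j' jt j't; apply: hs.
  exact: qf_equiv_trans (qf_equiv_sym (qf_embedding f j)) jt.
exact: qf_equiv_trans (qf_equiv_sym (qf_embedding f j')) j't.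
Qed.

Definition solves (t : task) : set (I -> I) := [set g |
  t_col t (fun k => g (t_left t k)) = t_col t (fun k => g (t_right t k)) /\
  same_qftp (fun k => g (t_left t k)) (t_left t)].

Definition solves_all (l : seq task) : set (I -> I) :=
  foldr (fun t D => solves t `&` D) setT l.

Lemma solves_all_nonempty l : solves_all l !=set0.
Proof.
pose entries := foldr (fun t S => range (t_left t) `|` range (t_right t) `|` S) set0.
have fin_entries : finite_set (entries l).
  elim: l => [|t l IH] /=; first exact: finite_set0.
  by rewrite !finite_setU; do !split => //; apply: finite_image; exact: finite_finset.
pose B := generated (entries l).
have [BX _] := generatesP (entries l).
have fgB : finitely_generated B by exists (entries l); split=> //; exact: generatesP.
have ageB : age I (sub_str B).
  apply/age_iff => //; split; last by exists val; exact: is_embedding_val.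
  apply: card_le_finite (I_locfin fgB);
    apply: (card_le_inj (f := val)) => [x _|x y _ _ /val_inj//].
  exact/set_mem/valP.
have [g gl] := ramsey_tasks l ageB.
pose G x := if pselect (sub_set B x) is left Bx then g (SigSub (mem_set Bx)) else x.
have GE (b : sub_str B) : G (val b) = g b.
  rewrite /G; case: pselect => [Bx|]; last by case; exact/set_mem/valP.
  by congr (g _); exact: val_inj.
suff key l' : foldr (fun t P => homogeneous g t /\ P) True l' ->
    entries l' `<=` sub_set B -> solves_all l' G by exists G; exact: key.
elim: l' => //= t l' IH [gt gl'] sub; split; last first.
  by apply: IH => // x ex; apply: sub; right.
have lift (i : 'I_(t_size t) -> I) : (forall k, sub_set B (i k)) ->
    exists i' : 'I_(t_size t) -> sub_str B, i = fun k => val (i' k).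
  by move=> iB; exists (fun k => SigSub (mem_set (iB k))).
have [|i iE] := lift (t_left t); first by move=> k; apply: sub; left; left; exists k.
have [|j jE] := lift (t_right t); first by move=> k; apply: sub; left; right; exists k.
have qi : qf_equiv i (t_left t) by rewrite iE; exact: (qf_embedding (sub_incl B)).
have qj : qf_equiv j (t_right t) by rewrite jE; exact: (qf_embedding (sub_incl B)).
have gi : (fun k => G (t_left t k)) = fun k => g (i k).
  by rewrite iE; apply: funext => k; exact: GE.
have gj : (fun k => G (t_right t k)) = fun k => g (j k).
  by rewrite jE; apply: funext => k; exact: GE.
rewrite /solves /= gi gj; split.
  by apply: gt => //; apply: qf_equiv_trans qj _; exact/qf_equiv_sym/t_same.
exact: qf_equiv_trans (qf_equiv_sym (qf_embedding g i)) qi.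
Qed.

Lemma ramsey_ultrafilter : exists U : set_system (I -> I),
  UltraFilter U /\ forall t, U (solves t).
Proof.
have FF : ProperFilter (filter_from [set: seq task] solves_all).
  apply: filter_from_proper; last by move=> l _; exact: solves_all_nonempty.
  apply: filter_fromT_filter; first by exists [::].
  move=> l1 l2; exists (l1 ++ l2); elim: l1 => [|t l1 IH] /=; first by rewrite setTI.
  by move=> g [gt /IH[g1 g2]]; split=> //; split.
have [U [UU FU]] := ultraFilterLemma FF; exists U; split=> // t.
by apply: FU; exists [:: t] => //= g [].
Qed.

End RamseyUltrafilter.

(** * Limits along an ultrafilter and their realization *)

Section UltraLimit.
Variables (R : realType) (X : Type) (U : set_system X).
Hypothesis UU : UltraFilter U.

Definition ulim (h : X -> R) (l : R) : Prop :=
  forall e, 0 < e -> U [set x | `|h x - l| <= e].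

Lemma ulim_uniq h l l' : ulim h l -> ulim h l' -> l = l'.
Proof.
move=> hl hl'; apply/eqP; rewrite -subr_eq0 -normr_le0; apply/ler_addgt0Pl => e e0.
have e2 : 0 < e / 2 by rewrite divr_gt0.
have [x [/= xl xl']] := filter_meet _ (hl _ e2) (hl' _ e2).
rewrite addr0 (le_trans (ler_distD (h x) _ _)) // [e]splitr distrC.
exact: lerD.
Qed.

(** The limit is the supremum of the lower bounds that [h] satisfies on a set in [U]. *)
Lemma ulim_exists h : (forall x, 0 <= h x <= 1) -> exists l, ulim h l.
Proof.
move=> h01; pose S := [set q : R | U [set x | q <= h x]].
have S0 : S 0 by apply: filterS (@filterT _ U _) => x _; have /andP[] := h01 x.
have S1 : ubound S 1.
  by move=> q /filter_ex[x /= qx]; apply: le_trans qx _; have /andP[] := h01 x.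
have supS : has_sup S by split; [exists 0|exists 1].
exists (sup S) => e e0.
have [q Sq qe] := sup_adherent e0 supS.
have nS : ~ S (sup S + e).
  by move=> /(ub_le_sup supS.2); rewrite gerDl leNgt e0.
have [//|nU] := in_ultra_setVsetC [set x | sup S + e <= h x] UU.
apply: filterS (filterI Sq nU) => x [/= qx /negP]; rewrite -ltNge => xs.
by rewrite ler_distl; apply/andP; split; lra.
Qed.

Lemma ulim_range h l : (forall x, 0 <= h x <= 1) -> ulim h l -> 0 <= l <= 1.
Proof.
move=> h01 hl; suff b e : 0 < e -> - e <= l <= 1 + e.
  apply/andP; split.
    by apply/ler_addgt0Pl => e /b/andP[? _]; lra.
  by apply/ler_addgt0Pr => e /b/andP[_ ?]; lra.
move=> e0; have /filter_ex[x /=] := hl _ e0; rewrite ler_distl => /andP[? ?].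
by have /andP[? ?] := h01 x; apply/andP; split; lra.
Qed.

Lemma ulim_dev h l : ulim h l -> ulim (fun x => `|h x - l|) 0.
Proof. by move=> hl e /hl; apply: filterS => x /=; rewrite subr0 normr_id. Qed.

Lemma ulim0_max h h' : ulim h 0 -> ulim h' 0 -> ulim (fun x => Num.max (h x) (h' x)) 0.
Proof.
move=> hl hl' e e0; apply: filterS (filterI (hl _ e0) (hl' _ e0)) => x [/=].
rewrite !subr0 !ler_norml le_max ge_max => /andP[-> ->] /andP[_ ->].
by [].
Qed.

Lemma ulim0_squeeze h h' : (forall x, 0 <= h x <= h' x) -> ulim h' 0 -> ulim h 0.
Proof.
move=> hh' hl e /hl; apply: filterS => x /=; rewrite !subr0.
have /andP[h0 hh] := hh' x; rewrite !ger0_norm //; first exact: le_trans.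
exact: le_trans hh.
Qed.

Lemma ulim_cst l : ulim (fun=> l) l.
Proof. by move=> e e0; apply: filterS (@filterT _ U _) => x _ /=;
  rewrite subrr normr0 ltW. Qed.

End UltraLimit.

Definition upd (V M : Type) (v0 : V) (b : V -> M) (y : M) (v : V) : M :=
  if pselect (v = v0) then y else b v.

Section Realize.
Variables (R : realType) (L : clang R) (M : cstruct L) (K V X : Type).
Hypothesis satM : saturated K M.
Hypothesis VK : card_lt [set: V] [set: K].
Variables (U : set_system X) (c : X -> V -> M).
Hypothesis UU : UltraFilter U.

Let lim (phi : cformula L V) l := ulim U (fun x => ceval phi (c x)) l.

Definition realizes (D : set V) (b : V -> M) : Prop :=
  forall phi, supported M D phi -> lim phi (ceval phi b).

Lemma updE (v0 : V) (b : V -> M) y : upd v0 b y v0 = y.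
Proof. by rewrite /upd; case: pselect. Qed.

Lemma updN (v0 : V) (b : V -> M) y v : v <> v0 -> upd v0 b y v = b v.
Proof. by rewrite /upd; case: pselect. Qed.

(** The infimum of [phi] over [v0] is supported on [D] and has limit 0, since [c x v0] is a
    competitor for each [x]. Hence it is 0 at [b], though possibly not attained. *)
Lemma realizes_inf (D : set V) (b : V -> M) v0 phi (d : R) :
  realizes D b -> supported M (D `|` [set v0]) phi -> lim phi 0 -> 0 < d ->
  exists y, ceval phi (upd v0 b y) < d.
Proof.
move=> Db sphi phi0 d0.
pose k v := if pselect (v = v0) then None else Some v.
pose theta : cformula L V := CInf (cf_map k phi).
have thetaE a : ceval theta a = inf [set ceval phi (upd v0 a y) | y in [set: M]].
  rewrite /=; congr inf; apply: eq_imagel => y _; rewrite ceval_map; congr ceval.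
  by apply: funext => v; rewrite /k /upd; case: pselect.
have lb a : has_inf [set ceval phi (upd v0 a y) | y in [set: M]].
  have [y0] := c_inhabited M; split; first by exists (ceval phi (upd v0 a y0)), y0.
  by exists 0 => _ [y _ <-]; have /andP[] := ceval_range phi (upd v0 a y).
have stheta : supported M D theta.
  move=> a a' aa'; rewrite !thetaE; congr inf; apply: eq_imagel => y _; apply: sphi.
  by move=> v Dv; rewrite /upd; case: pselect => // nv; apply: aa'; case: Dv.
have theta0 : lim theta 0.
  apply: ulim0_squeeze phi0 => x; have /andP[-> _] := ceval_range theta (c x).
  rewrite thetaE; apply: ge_inf; first by case: (lb (c x)).
  exists (c x v0) => //; congr ceval; apply: funext => v.
  by rewrite /upd; case: pselect => //= ->.
have e0 : ceval theta b = 0 by apply: ulim_uniq (Db _ stheta) theta0.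
have [_ [y _ <-]] := inf_adherent d0 (lb b).
by rewrite -thetaE e0 add0r; exists y.
Qed.

Lemma realizes_extend (D : set V) (b : V -> M) v0 : realizes D b -> ~ D v0 ->
  exists y, realizes (D `|` [set v0]) (upd v0 b y).
Proof.
move=> Db nD; pose D' := D `|` [set v0]; pose A := b @` D.
have AK : card_lt A [set: K].
  have AV : A #<= [set: V] by apply: card_le_trans (card_image_le _ _) _;
    exact: subset_card_le.
  split; first exact: card_le_trans AV VK.1.
  by move=> KA; apply: VK.2; exact: card_le_trans AV.
pose k v : 'I_1 + A := if pselect (D v) is left Dv then
  inr (SigSub (mem_set (ex_intro2 _ _ v Dv erefl : A (b v)))) else inl ord0.
have kE (x : 'I_1 -> M) v : D' v -> param_assign x (k v) = upd v0 b (x ord0) v.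
  rewrite /k; case: pselect => /= [Dv _|nDv [//|->]]; last by rewrite updE.
  by rewrite updN // => vv0; apply: nD; rewrite -vv0.
have evalE phi (x : 'I_1 -> M) : supported M D' phi ->
    ceval (cf_map k phi) (param_assign x) = ceval phi (upd v0 b (x ord0)).
  by move=> sphi; rewrite ceval_map; apply: sphi => v; exact: kE.
(* The conditions say [phi <= e] for each positive [e] instead of [phi = 0]: finite parts are
   satisfiable only approximately. *)
pose Gamma := [set psi : cformula L ('I_1 + A) | exists phi (e : R) (e0 : 0 < e),
  [/\ supported M D' phi, lim phi 0 & psi = cf_map k (cf_sub (ltW e0) phi)]].
have ssub phi e (e0 : 0 <= e) : supported M D' phi -> supported M D' (cf_sub e0 phi).
  by move=> sphi a a' aa'; rewrite !ceval_sub (sphi a a').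
have [|x xG] := satM AK (Gamma := Gamma).
  move=> G0 /finite_set_enum[m [s ->]] sG.
  have {}sG i : Gamma (s i) by apply: sG; exists i.
  suff [phi [d [d0 sphi phi0 dP]]] : exists phi d, [/\ 0 < d, supported M D' phi, lim
    phi 0 &
      forall x : 'I_1 -> M, ceval phi (upd v0 b (x ord0)) < d ->
      forall i, ceval (s i) (param_assign x) = 0].
    have [y yd] := realizes_inf Db sphi phi0 d0.
    by exists (fun=> y) => _ [i _ <-]; exact: dP.
  elim: m s sG => [|m IH] s sG.
    (* The empty conjunction: a formula that is identically 0, with any positive tolerance. *)
    exists (CDist (Var _ v0) (Var _ v0)), 1; split.
    - exact: ltr01.
    - by move=> a a' _; rewrite /= !mdistxx.
    - rewrite /lim (_ : (fun x => _) = fun=> 0); first exact: ulim_cst.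
      by apply: funext => x /=; rewrite mdistxx.
    - by move=> x _ [].
  have [phi [d [d0 sphi phi0 dP]]] := IH _ (fun i => sG (lift ord0 i)).
  have [phi1 [e [e0 [sphi1 phi10 sE]]]] := sG ord0.
  exists (cf_max phi1 phi), (Num.min e d); split.
  - by rewrite lt_min e0.
  - by move=> a a' aa'; rewrite !ceval_max (sphi a a') // (sphi1 a a').
  - rewrite /lim; have := ulim0_max UU phi10 phi0.
    by congr (ulim U _ _); apply: funext => x; rewrite ceval_max.
  - move=> x; rewrite ceval_max lt_min !gt_max => /andP[/andP[h1 _] /andP[_ h2]] i.
    case: (unliftP ord0 i) => [j ->|->]; first exact: dP.
    by rewrite sE evalE ?ceval_sub; [apply/max_idPl; rewrite subr_le0 ltW|exact: ssub].
exists (x ord0) => phi sphi.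
have [l hl] := ulim_exists UU (fun x => ceval_range phi (c x)).
have l01 := ulim_range UU (fun x => ceval_range phi (c x)) hl.
suff -> : ceval phi (upd v0 b (x ord0)) = l by [].
apply/eqP; rewrite -subr_eq0 -normr_le0; apply/ler_addgt0Pl => e e0; rewrite addr0.
(* The condition that [phi] has its limit value [l] is brought to the form of a formula with limit
   0. *)
have sdev : supported M D' (cf_dev l01 phi).
  by move=> a a' aa'; rewrite !ceval_dev (sphi a a').
have /xG : Gamma (cf_map k (cf_sub (ltW e0) (cf_dev l01 phi))).
  exists (cf_dev l01 phi), e, e0; split=> //.
  rewrite /lim; have := ulim_dev UU hl.
  by congr (ulim U _ _); apply: funext => z; rewrite ceval_dev.
rewrite evalE; last exact: ssub.
by rewrite ceval_sub ceval_dev => /max_idPl; rewrite subr_le0.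
Qed.

Lemma supportedI (D E : set V) phi : supported M D phi -> supported M E phi ->
  supported M (D `&` E) phi.
Proof.
move=> sD sE a b ab.
rewrite (sD a (fun v => if pselect (D v) then a v else b v)); last first.
  by move=> v Dv; case: pselect.
by apply: sE => v Ev; case: pselect => // Dv; exact: ab.
Qed.

Lemma supportedS (D E : set V) phi : D `<=` E -> supported M D phi -> supported M E phi.
Proof. by move=> DE sD a b ab; apply: sD => v /DE; exact: ab. Qed.

(** Saturation realizes types in finitely many variables, while [V] may be infinite. Variables are
    therefore added one at a time under Zorn's lemma; unions of chains remain realizations because
    every formula has finite support. *)
Lemma realize : exists b : V -> M, forall phi, lim phi (ceval phi b).
Proof.
have [y0] := c_inhabited M.
pose T := {p : set V * (V -> M) | realizes p.1 p.2}.
(* Values off the domain are arbitrary, so this is only a preorder. *)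
pose le (p q : set V * (V -> M)) := p.1 `<=` q.1 /\ forall v, p.1 v -> p.2 v = q.2 v.
pose p0 : set V * (V -> M) := (set0, fun=> y0).
have r0 : realizes p0.1 p0.2.
  move=> phi sphi /=; rewrite /lim.
  rewrite (_ : (fun x => _) = fun=> ceval phi (fun=> y0)); first exact: ulim_cst.
  by apply: funext => x; exact: sphi.
pose t0 : T := exist (fun p => realizes p.1 p.2) p0 r0.
have [|||[[D b] /= Db] Dmax] :=
  @ZL_preorder T t0 (fun p q => `[<le (sval p) (sval q)>]).
- by move=> t; apply/asboolP; split.
- move=> r s t /asboolP[rs rs'] /asboolP[st st']; apply/asboolP.
  split; first exact: subset_trans st.
  by move=> v rv; rewrite rs' // st' //; exact: rs.
- move=> A Atot; have [[t1 At1]|A0] := pselect (exists t, A t); last first.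
    by exists t0 => s As; case: A0; exists s.
  pose F := [set (sval t).1 | t in A].
  have Ftot : total_on F subset.
    by move=> _ _ [s As <-] [t At <-];
      have [/asboolP[]|/asboolP[]] := Atot s t As At; auto.
  pose D := \bigcup_(S in F) S.
  have /choice[b bP] : forall v, exists y, forall t, A t -> (sval t).1 v ->
    (sval t).2 v = y.
    move=> v; have [[t [At tv]]|nt] := pselect (exists t, A t /\ (sval t).1 v);
      last first.
      by exists y0 => t At tv; case: nt; exists t.
    exists ((sval t).2 v) => s As sv.
    by have [/asboolP[_ h]|/asboolP[_ h]] := Atot s t As At; [rewrite h|rewrite h].
  have Db : realizes (D, b).1 (D, b).2.
    move=> phi sphi /=; have [S finS sS] := ceval_finite_support M phi.
    have {}sS := supportedI sS sphi.
    have [k [s sE]] := finite_set_enum (finite_setIl D finS).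
    have [||_ [t At <-] st] := chain_tuple (z := s) Ftot.
    - by exists (sval t1).1; exists t1.
    - by move=> i; have [] : (S `&` D) (s i) by rewrite sE; exists i.
    have subt : S `&` D `<=` (sval t).1 by rewrite sE => _ [i _ <-].
    have st' := supportedS subt sS.
    have -> : ceval phi b = ceval phi (sval t).2 by apply: st' => v tv;
      rewrite (bP v t).
    exact: (svalP t).
  exists (exist _ (D, b) Db) => t At; apply/asboolP; split=> [v tv|v tv] /=.
    by exists (sval t).1 => //; exists t.
  exact: bP.
have DT v : D v.
  apply: contrapT => nD; have [y yD] := realizes_extend Db nD.
  pose q : T := exist (fun p => realizes p.1 p.2) (D `|` [set v], upd v b y) yD.
  have le_q : le (D, b) (sval q).
    split=> [w|w Dw] /=; first by left.
    by rewrite updN // => wv; apply: nD; rewrite -wv.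
  have /asboolP[sub _] := Dmax q (asboolT le_q).
  by apply: nD; apply: sub; right.
by exists b => phi; apply: (Db phi) => a a' aa'; congr ceval; apply: funext => v;
  exact: aa'.
Qed.

End Realize.

(** The index is the integer part of [v * N.+1]; the extra cell, the last of [N.+2], receives
    [v = 1]. *)
Lemma cell_colouring (R : realType) (N : nat) (v : R) : 0 <= v <= 1 ->
  exists k : 'I_N.+2, k%:R / N.+1%:R <= v <= k.+1%:R / N.+1%:R.
Proof.
move=> /andP[v0 v1]; have N0 : (0 : R) < N.+1%:R by rewrite ltr0n.
have vN0 : 0 <= v * N.+1%:R by rewrite mulr_ge0 // ltW.
have /andP[t1 t2] := Num.Theory.truncn_itv vN0.
have lt : (Num.truncn (v * N.+1%:R) < N.+2)%N.
  by rewrite ltnS -(ler_nat R) (le_trans t1) // ler_piMl // ltW.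
by exists (Ordinal lt); rewrite ler_pdivrMr // ler_pdivlMr // t1 ltW.
Qed.

Lemma modeling_of_ramsey (R : realType) (L' : folang) (I : fostruct L')
    (L : clang R) (T : ctheory L) : locally_finite I ->
  embedding_ramsey_property (age I) -> continuous_modeling_property I T.
Proof.
move=> locfin erp K M [_ [NK _ _] satM _] IK J JK a.
(* [U] does not depend on [a]: it solves the tasks of all finite colourings, hence those of all
   formulas and precisions. *)
have [U [UU UP]] := ramsey_ultrafilter locfin erp.
pose c (g : I -> I) (v : I * J) : M := a (g v.1) v.2.
have [b0 b0P] := realize satM (card_lt_prod NK IK JK) c UU.
pose b i j := b0 (i, j).
have bP n (i : 'I_n -> I) phi :
    ulim U (fun g => ceval phi (subtuple a (fun k =>
      g (i k)))) (ceval phi (subtuple b i)).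
  pose k (v : 'I_n * J) := (i v.1, v.2).
  have := b0P (cf_map k phi); rewrite ceval_map.
  rewrite (_ : (fun v => b0 (k v)) = subtuple b i) //.
  by congr (ulim U _ _); apply: funext => g; rewrite ceval_map.
exists b; split.
  move=> n i j ij phi; apply/eqP; rewrite -subr_eq0 -normr_le0.
  apply/ler_addgt0Pl => e e0; rewrite addr0.
  (* One third for each of the two limits, and one for the width of a cell. *)
  have e3 : 0 < e / 3 by rewrite divr_gt0.
  have [N Ne] : exists N : nat, N.+1%:R^-1 <= e / 3.
    exists (Num.truncn (e / 3)^-1);
      rewrite -[X in _ <= X]invrK lef_pV2 ?posrE ?invr_gt0 ?ltr0n //.
    by rewrite ltW //; have /andP[] :=
      Num.Theory.truncn_itv (ltW (etrans (invr_gt0 _) e3)).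
  have /choice[col colP] : forall x : 'I_n -> I, exists k : 'I_N.+2,
      k%:R / N.+1%:R <= ceval phi (subtuple a x) <= k.+1%:R / N.+1%:R.
    by move=> x; apply: cell_colouring; exact: ceval_range.
  have Uij := UP (Task ij col).
  have [g [[/= gi gj] [gcol _]]] :=
    filter_meet _ (filterI (bP n i phi _ e3) (bP n j phi _ e3)) Uij.
  have := colP (fun k => g (i k)); have := colP (fun k => g (j k)).
  have cell (k : nat) : k.+1%:R / N.+1%:R = k%:R / N.+1%:R + N.+1%:R^-1 :> R.
    by rewrite -[k.+1%:R]natr1 mulrDl mul1r.
  have <- : col (fun k => g (i k)) = col (fun k => g (j k)) by exact: gcol.
  rewrite !cell; set q := _ / _; set w := _^-1 in Ne *.
  move=> /andP[j1 j2] /andP[i1 i2].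
  by move: gi gj; rewrite !ler_distl => /andP[? ?] /andP[? ?]; apply/andP; split; lra.
move=> n Delta j e /finite_set_enum[m [s ->]] e0.
have U1 : U [set g | forall l, `|ceval (s l) (subtuple a (fun k => g (j k))) -
    ceval (s l) (subtuple b j)| <= e].
  by apply: filter_forall => l; exact: bP.
(* A task with one colour and equal sides expresses just that [g] preserves the quantifier-free type
   of [j]. *)
have jj : same_qftp j j by move=> psi.
have [g [gs [_ gq]]] := filter_meet _ U1 (UP (Task jj (fun=> ord0 : 'I_1))).
exists (fun k => g (j k)); split=> // _ [l _ <-].
by rewrite distrC; exact: gs.
Qed.

Theorem theorem5p10 (R : realType) (L' : folang) (I : fostruct L')
    (I_infinite : infinite_set [set: I]) (I_locfin : locally_finite I) :
  embedding_ramsey_property (age I) <->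
  (forall (L : clang R) (T : ctheory L), complete_theory T ->
     continuous_modeling_property I T).
Proof.
split=> [erp L T _|modeling]; first exact: modeling_of_ramsey.
exact: ramsey_of_modeling modeling.
Qed.
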